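(* Let $k$ be a field, let $A$ be a coherent $k$-algebra and let $B$ be a finite-dimensional $k$-algebra of finite global dimension. Let $X$ be a finitely presented left $A\otimes_k B$-module. Then $X$ is a Gorenstein projective $A\otimes_k B$-module if and only if ${}_A(X/\mathrm{rad}_BX)$ is a Gorenstein projective left $A$-module and ${}_BX$ is a projective left $B$-module.
   Context: All modules are left modules unless stated otherwise. A $k$-algebra is coherent if it is both left and right coherent as a ring. For an $A\otimes_k B$-module $X$, ${}_AX$ and ${}_BX$ denote the underlying left $A$-module and left $B$-module of $X$. For a left $B$-module $M$, $\mathrm{rad}_BM$ is the intersection of all maximal submodules of $M$; $\mathrm{rad}_BX$ denotes $\mathrm{rad}_B({}_BX)$, which equals $\mathrm{rad}B\cdot X$ and is an $A\otimes_k B$-submodule of $X$, so that $X/\mathrm{rad}_BX$ is an $A\otimes_k B$-module (in particular an $A$-module). For a $k$-algebra $R$, a complex $P^\bullet$ of projective $R$-modules (unbounded in both directions) is totally acyclic if $P^\bullet$ is acyclic and $\mathrm{Hom}_R(P^\bullet,Q)$ is acyclic for each projective $R$-module $Q$. An $R$-module $M$ is Gorenstein projective if there is a totally acyclic complex $P^\bullet$ of projective $R$-modules with differentials $d^i:P^i\to P^{i+1}$ such that $M=\mathrm{Ker}\, d^1$. *)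

(* Defs.v *)
(* MathComp, with the classical axioms of mathcomp.classical.boolp.
   Modules are left modules ([lmodType]).  Algebras ([algType], [falgType])
   are unital, associative and, as everywhere in MathComp, nonzero. *)
From HB Require Import structures.
From mathcomp Require Import all_boot all_algebra falgebra boolp.

Set Implicit Arguments.
Unset Strict Implicit.
Unset Printing Implicit Defensive.

Import GRing.Theory.
Local Open Scope ring_scope.
Local Open Scope quotient_scope.

Section ModuleNotions.
Variable R : nzRingType.
Implicit Types M N U V Q : lmodType R.

Definition exact_at U V N (f : {linear U -> V}) (g : {linear V -> N}) : Prop :=
  forall y, g y = 0 <-> exists x, f x = y.

Definition surjective U V (f : {linear U -> V}) : Prop :=
  forall y, exists x, f x = y.

Definition projective M : Prop :=
  forall U V (g : {linear U -> V}) (f : {linear M -> V}),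
    surjective g -> exists h : {linear M -> U}, forall x, g (h x) = f x.

Definition finitely_generated M : Prop :=
  exists n (p : {linear 'rV[R]_n -> M}), surjective p.

Definition finitely_presented M : Prop :=
  exists m n (q : {linear 'rV[R]_m -> 'rV[R]_n}) (p : {linear 'rV[R]_n -> M}),
    exact_at q p /\ surjective p.

(* Every finitely generated left ideal is finitely presented; a left ideal is
   given as a module with an injective linear map to the regular module. *)
Definition left_coherent : Prop :=
  forall (I : lmodType R) (i : {linear I -> R^o}),
    injective i -> finitely_generated I -> finitely_presented I.

(* There is a projective resolution
   ... -> P 2 -> P 1 -> P 0 -> M -> 0 with P i = 0 for i > n. *)
Definition projdim_le n M : Prop :=
  exists (P : nat -> lmodType R) (d : forall i, {linear P i.+1 -> P i})
    (e : {linear P 0 -> M}),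
  [/\ forall i, projective (P i),
      surjective e,
      exact_at (d 0) e,
      forall i, exact_at (d i.+1) (d i)
    & forall i, (n < i)%N -> forall x : P i, x = 0].

Definition finite_global_dimension : Prop :=
  exists n, forall M, projdim_le n M.

Record complex := Complex {
  cobj :> int -> lmodType R;
  cdiff : forall i, {linear cobj i -> cobj (i + 1)};
  cdiff_comp : forall i x, cdiff (i + 1) (cdiff i x) = 0
}.

Definition acyclic (P : complex) : Prop :=
  forall i, exact_at (cdiff P i) (cdiff P (i + 1)).

(* Acyclicity of Hom_R(P, Q), written at the spot Hom_R(P (i + 1), Q). *)
Definition Hom_acyclic (P : complex) Q : Prop :=
  forall i (f : {linear P (i + 1) -> Q}),
    (forall x, f (cdiff P i x) = 0) <->
    exists g : {linear P (i + 1 + 1) -> Q},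
      forall x, g (cdiff P (i + 1) x) = f x.

Definition totally_acyclic (P : complex) : Prop :=
  [/\ forall i, projective (P i),
      acyclic P
    & forall Q, projective Q -> Hom_acyclic P Q].

(* [j] identifies M with the kernel of d^1. *)
Definition Gorenstein_projective M : Prop :=
  exists P : complex, totally_acyclic P /\
    exists j : {linear M -> P 1}, injective j /\ exact_at j (cdiff P 1).

Definition maximal_submodule M (N : {pred M}) : Prop :=
  [/\ submod_closed N,
      exists x, x \notin N
    & forall N' : {pred M}, submod_closed N' -> {subset N <= N'} ->
        (exists x, x \notin N') -> {subset N' <= N}].

Definition rad M : {pred M} :=
  fun x => `[< forall N : {pred M}, maximal_submodule N -> x \in N >].

Arguments rad : clear implicits.

Lemma radP M (x : M) :
  reflect (forall N : {pred M}, maximal_submodule N -> x \in N) (x \in rad M).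
Proof. exact: asboolP. Qed.

Lemma rad_submod_closed M : submod_closed (rad M).
Proof.
split=> [|a u v /radP ru /radP rv]; apply/radP => N maxN;
  have [[N0 NP] _ _] := maxN; first exact: N0.
by apply: NP; [apply: ru | apply: rv].
Qed.

Lemma rad_linear M N (f : {linear M -> N}) x : x \in rad M -> f x \in rad N.
Proof.
move=> /radP rx; apply/radP => L [[L0 LP] [z nLz] maxL].
apply: contraT => nLfx.
suff /rx Lfx : maximal_submodule [pred y | f y \in L] by case/negP: nLfx.
split; last 1 first.
- move=> K [K0 KP] sLK [w nKw] y Ky; rewrite inE.
  apply: contraT => nLfy.
  (* L + f K would be a submodule strictly above L *)
  pose L' : {pred N} := fun u => `[< exists2 v, v \in K & u - f v \in L >].
  have L'P u : reflect (exists2 v, v \in K & u - f v \in L) (u \in L').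
    exact: asboolP.
  have sL' : submod_closed L'.
    split=> [|a u v /L'P[u' Ku' Lu] /L'P[v' Kv' Lv]]; apply/L'P.
      by exists 0; rewrite // linear0 subr0.
    exists (a *: u' + v'); first exact: KP.
    rewrite linearP opprD addrACA -scalerBr; exact: LP.
  have LL' : {subset L <= L'}.
    by move=> u Lu; apply/L'P; exists 0; rewrite // linear0 subr0.
  have fw : f w \notin L'.
    apply/negP => /L'P[v Kv Lwv]; case/negP: nKw.
    rewrite -(subrK v w) -[w - v]scale1r; apply: KP => //.
    by apply: sLK; rewrite inE linearB.
  have/negP := nLfy; case; apply: maxL sL' LL' _ _ _; first by exists (f w).
  by apply/L'P; exists y; rewrite // subrr.
- by split=> [|a u v]; rewrite !inE ?linear0 // => Lu Lv; rewrite linearP LP.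
- by exists x.
Qed.

End ModuleNotions.

Arguments rad {R} M.

HB.instance Definition _ (R : nzRingType) (M : lmodType R) :=
  GRing.isSubmodClosed.Build R M (rad M) (rad_submod_closed M).

(* Right modules over R are left modules over the converse ring R^c. *)
Definition coherent (R : nzRingType) : Prop :=
  left_coherent R /\ left_coherent R^c.

Definition restrict_scalars (R S : nzRingType) (f : {rmorphism R -> S})
  (X : lmodType S) : Type := X.

Section RestrictScalars.
Variables (R S : nzRingType) (f : {rmorphism R -> S}) (X : lmodType S).

HB.instance Definition _ := GRing.Zmodule.on (restrict_scalars f X).

Let scale (a : R) (x : restrict_scalars f X) : restrict_scalars f X :=
  f a *: (x : X).

Let scaleA a b x : scale a (scale b x) = scale (a * b) x.
Proof. by rewrite /scale scalerA rmorphM. Qed.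

Let scale1 : left_id 1 scale.
Proof. by move=> x; rewrite /scale rmorph1 scale1r. Qed.

Let scaleDr : right_distributive scale +%R.
Proof. by move=> a x y; exact: scalerDr. Qed.

Let scaleDl x : {morph scale^~ x : a b / a + b}.
Proof. by move=> a b; rewrite /scale rmorphD scalerDl. Qed.

HB.instance Definition _ := GRing.Zmodule_isLmodule.Build R
  (restrict_scalars f X) scaleA scale1 scaleDr scaleDl.

Lemma restrict_scaleE (a : R) (x : restrict_scalars f X) :
  a *: x = f a *: (x : X).
Proof. by []. Qed.

End RestrictScalars.

Section QuotientModule.
Variables (R : nzRingType) (M : lmodType R) (S : submodClosed M).

Definition modquot_pred : {pred M} := S.

HB.instance Definition _ :=
  GRing.isZmodClosed.Build M modquot_pred
    (GRing.submod_closedB (GRing.submodClosedP S)).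

Definition modquot : Type := Quotient.quot modquot_pred.

HB.instance Definition _ := GRing.Zmodule.on modquot.

Definition modproj (x : M) : modquot := \pi_(Quotient.quot modquot_pred) x.

Lemma modproj_eq x y : (modproj x = modproj y) <-> (x - y \in S).
Proof.
by rewrite -[_ \in S]/(x - y \in modquot_pred) Quotient.idealrBE; split=> /eqP.
Qed.

Lemma modproj_surj (q : modquot) : exists x, modproj x = q.
Proof. by exists (repr q); rewrite /modproj reprK. Qed.

Lemma modprojD : {morph modproj : x y / x + y}.
Proof. by move=> x y; rewrite /modproj raddfD. Qed.

Let scale (a : R) (q : modquot) : modquot := modproj (a *: repr q).

Let scale_proj a x : scale a (modproj x) = modproj (a *: x).
Proof.
apply/modproj_eq; rewrite -scalerBr rpredZ //.
by apply/modproj_eq; rewrite /modproj reprK.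
Qed.

Let scaleA a b q : scale a (scale b q) = scale (a * b) q.
Proof. by have [x <-] := modproj_surj q; rewrite !scale_proj scalerA. Qed.

Let scale1 : left_id 1 scale.
Proof. by move=> q; have [x <-] := modproj_surj q; rewrite scale_proj scale1r. Qed.

Let scaleDr : right_distributive scale +%R.
Proof.
move=> a p q; have [x <-] := modproj_surj p; have [y <-] := modproj_surj q.
by rewrite -modprojD !scale_proj scalerDr modprojD.
Qed.

Let scaleDl q : {morph scale^~ q : a b / a + b}.
Proof.
move=> a b; have [x <-] := modproj_surj q.
by rewrite !scale_proj scalerDl modprojD.
Qed.

HB.instance Definition _ :=
  GRing.Zmodule_isLmodule.Build R modquot scaleA scale1 scaleDr scaleDl.

Lemma modproj_linear : linear modproj.
Proof. by move=> a x y; rewrite modprojD -scale_proj. Qed.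

HB.instance Definition _ := GRing.isLinear.Build R M modquot _ modproj
  modproj_linear.

End QuotientModule.

(* A tensor product of the k-algebras A and B: an algebra in which
   a (x) b = tensl a * tensr b, with (a (x) b)(a' (x) b') = aa' (x) bb'
   (the copies of A and B commute), and which has the universal property of
   the tensor product of the underlying vector spaces. *)
Record tensor_product (k : fieldType) (A B : algType k) := TensorProduct {
  tens :> algType k;
  tensl : {lrmorphism A -> tens};
  tensr : {lrmorphism B -> tens};
  tens_comm : forall a b, tensl a * tensr b = tensr b * tensl a;
  tens_lift : forall (V : lmodType k) (f : {bilinear A -> B -> V}),
    exists g : {linear tens -> V}, forall a b, g (tensl a * tensr b) = f a b;
  tens_uniq : forall (V : lmodType k) (g h : {linear tens -> V}),
    (forall a b, g (tensl a * tensr b) = h (tensl a * tensr b)) -> g =1 h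
}.

Section RadB.
Variables (k : fieldType) (A B : algType k) (T : tensor_product A B).
Variable X : lmodType T.

Definition radB : {pred X} := rad (restrict_scalars (tensr T) X).

Definition act_tensl (a : A) (x : restrict_scalars (tensr T) X) :
  restrict_scalars (tensr T) X := tensl T a *: (x : X).

Let act_tensl_linear a : linear (act_tensl a).
Proof.
move=> b x y; rewrite /act_tensl !restrict_scaleE.
by rewrite scalerDr !scalerA tens_comm.
Qed.

HB.instance Definition _ a := GRing.isLinear.Build B
  (restrict_scalars (tensr T) X) (restrict_scalars (tensr T) X) _ (act_tensl a)
  (act_tensl_linear a).

(* The scalars t with t rad_B X <= rad_B X form a k-subspace containing every
   a (x) b, hence all of A (x) B: the radical is an A (x) B-submodule. *)
Definition radB_stab : {pred (tens T : lmodType k)} :=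
  fun t => `[< forall x, x \in radB -> t *: x \in radB >].

Let radB_stabP (t : T) :
  reflect (forall x, x \in radB -> t *: x \in radB) (t \in radB_stab).
Proof. exact: asboolP. Qed.

Let radB_add x y : x \in radB -> y \in radB -> x + y \in radB.
Proof. exact: (@rpredD _ (rad (restrict_scalars (tensr T) X))). Qed.

Let radB_tens a b x : x \in radB -> (tensl T a * tensr T b) *: x \in radB.
Proof.
move=> rx; rewrite -scalerA; apply: (@rad_linear _ _ _ (act_tensl a)).
exact: (@rpredZ _ _ (rad (restrict_scalars (tensr T) X)) b x rx).
Qed.

Let radB_stab_submod : submod_closed radB_stab.
Proof.
split=> [|c s t /radB_stabP Ss /radB_stabP St]; apply/radB_stabP => x rx.
  rewrite scale0r; exact: (@rpred0 _ (rad (restrict_scalars (tensr T) X))).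
rewrite scalerDl; apply: radB_add; last exact: St.
have -> : c *: s = tensl T c%:A * tensr T 1 * s.
  by rewrite linearZ !rmorph1 mulr1 mulr_algl.
by rewrite -scalerA; apply/radB_tens/Ss.
Qed.

HB.instance Definition _ := GRing.isSubmodClosed.Build k (tens T) radB_stab
  radB_stab_submod.

Lemma radB_submod_closed : submod_closed radB.
Proof.
split=> [|t x y rx ry].
  exact: (@rpred0 _ (rad (restrict_scalars (tensr T) X))).
apply: radB_add ry; apply: (elimT (radB_stabP t)) rx.
rewrite -[t]subr0; apply/modproj_eq; rewrite raddf0.
pose z : {linear T -> modquot radB_stab} := \0.
apply: (@tens_uniq _ _ _ T _ (modproj radB_stab) z) => a b /=.
rewrite -(raddf0 (modproj radB_stab)); apply/modproj_eq; rewrite subr0.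
by apply/radB_stabP => x'; exact: radB_tens.
Qed.

HB.instance Definition _ :=
  GRing.isSubmodClosed.Build T X radB radB_submod_closed.

End RadB.

Arguments radB {k A B T} X.

(* Main.v *)
(* Write J = rad B and D = Hom_k(B/J, k), a left B-module.  Gorenstein
   projectivity is used in a coinductive form: M lies in a class of modules N
   with Ext^1(N, Q) = 0 for Q projective, each N being both the kernel and the
   cokernel of maps between projectives whose other end lies in the class.

   The link between A (x) B and A is the adjunction
     Hom_{A(x)B}(X, Q (x) D) = Hom_A(X/JX, Q).
   If X is Gorenstein projective, finite global dimension forces all syzygies
   in a complete resolution to be projective over B, so reducing modulo J keeps
   the resolution exact; Ext^1_A(X/JX, Q) = 0 because D has a finite resolution
   by projectives P, and the modules Q (x) P are projective.

   Conversely, if X is projective over B and X/JX is Gorenstein projective, then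
   Ext^1(X, Q (x) M) = 0 for every finite-dimensional B-module M: filter M by
   its radical series, each layer of which is a direct summand of a power of D
   because B/J is semisimple.  An embedding X/JX -> Q with Gorenstein projective
   cokernel gives X -> Q (x) D, which lifts along Q (x) F -> Q (x) D for a
   finite-dimensional projective F mapping onto D.  The lift X -> Q (x) F splits over B since J is
   nilpotent, and its cokernel is again of the same type by the dual of
   Schanuel's lemma. *)
Require Import Defs.
From mathcomp Require Import all_boot all_algebra falgebra.
From HB Require Import structures.
From mathcomp Require Import boolp finmap.
From mathcomp Require classical_sets.
From mathcomp.multinomials Require monalg.
(* [all_algebra] also defines a [rad]. *)
Import Defs.

Set Implicit Arguments.
Unset Strict Implicit.
Unset Printing Implicit Defensive.
Import GRing.Theory.
Local Open Scope ring_scope.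

(** * Modules and extensions *)

(** Two obstacles shape the argument. Reduction modulo J is only right exact, and Q (x) D is in
    general not projective over A (x) B. The first disappears on short exact sequences ending in a
    B-projective module: they split over B, though not over A (x) B, and a B-linear splitting
    already controls radicals. The second is why Ext^1(X, Q (x) M) has to vanish for every
    finite-dimensional M and not only for projective M: with K the kernel of F -> D, the obstruction
    to lifting X -> Q (x) D to Q (x) F lies in Ext^1(X, Q (x) K).

    No Ext group is formed and only degree one occurs. A vanishing in higher degree is replaced by
    passing to a syzygy, which stays in the class under consideration. Syzygies and cosyzygies are
    determined only up to projective summands, so all notions involved are shown to be invariant
    under stable isomorphism. *)

Lemma dep_choice (I : Type) (T : I -> Type) (H : forall i, T i -> Prop) :
  (forall i, exists t, H i t) -> exists f : forall i, T i, forall i, H i (f i).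
Proof.
by move=> Hex; exists (fun i => projT1 (cid (Hex i))) => i; case: (cid _).
Qed.

Section Submodule.
Variables (R : nzRingType) (M : lmodType R) (S : submodClosed M).

Record subm : Type := Subm { subm_val : M; _ : subm_val \in (S : {pred M}) }.
HB.instance Definition _ := [isSub for subm_val].
HB.instance Definition _ := [Choice of subm by <:].
HB.instance Definition _ := [SubChoice_isSubLmodule of subm by <:].

End Submodule.

Section Modules.
Variable R : nzRingType.
Implicit Types M N K P Q U V W Z : lmodType R.

Definition mklin U V (f : U -> V) (lf : linear f) : {linear U -> V} :=
  HB.pack f (GRing.isLinear.Build R U V _ f lf).

Lemma mklinE U V (f : U -> V) (lf : linear f) x : mklin lf x = f x.
Proof. by []. Qed.

Lemma lin_sum_linear n U V (f : 'I_n -> {linear U -> V}) :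
  linear (fun x => \sum_i f i x).
Proof.
move=> a u v; rewrite scaler_sumr -big_split; apply: eq_bigr => i _ /=.
by rewrite linearP.
Qed.

Definition lin_sum n U V (f : 'I_n -> {linear U -> V}) := mklin (lin_sum_linear f).

Lemma factor_surj U V W (s : {linear U -> V}) (f : {linear U -> W}) :
  surjective s -> (forall x, s x = 0 -> f x = 0) ->
  exists g : {linear V -> W}, forall x, g (s x) = f x.
Proof.
move=> s_surj sf; pose t y := projT1 (cid (s_surj y)).
have st y : s (t y) = y := projT2 (cid (s_surj y)).
have ft x : f (t (s x)) = f x.
  by apply/eqP; rewrite -subr_eq0 -linearB sf // linearB st subrr.
have lg : linear (f \o t).
  move=> a u v /=; rewrite -linearP -{1}(st u) -{1}(st v) -linearP; exact: ft.
by exists (mklin lg) => x; exact: ft.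
Qed.

Lemma factor_inj N P U (j : {linear N -> P}) (f : {linear U -> P}) :
  injective j -> (forall x, exists y, j y = f x) ->
  exists g : {linear U -> N}, forall x, j (g x) = f x.
Proof.
move=> j_inj jf; pose t x := projT1 (cid (jf x)).
have jt x : j (t x) = f x := projT2 (cid (jf x)).
have lt : linear t by move=> a u v; apply: j_inj; rewrite linearP !jt linearP.
by exists (mklin lt).
Qed.

Lemma submodule_exists M (H : M -> Prop) :
  H 0 -> (forall a u v, H u -> H v -> H (a *: u + v)) ->
  exists (K : lmodType R) (i : {linear K -> M}),
    injective i /\ forall x, H x <-> exists y, i y = x.
Proof.
move=> H0 HP; pose S : {pred M} := fun x => `[< H x >].
have SP : submod_closed S.
  by split=> [|a u v /asboolP Hu /asboolP Hv]; apply/asboolP; [|apply: HP].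
pose S' : submodClosed M := HB.pack S (GRing.isSubmodClosed.Build R M S SP).
have l_val : linear (@subm_val R M S') by move=> a u v.
exists (subm S'), (mklin l_val); split=> [|x]; first exact: val_inj.
split=> [Hx|[y <-]].
  have Sx : x \in (S' : {pred M}) by apply/asboolP.
  by exists (Subm Sx).
by apply/asboolP; case: y.
Qed.

Lemma quotient_exists M (H : M -> Prop) :
  H 0 -> (forall a u v, H u -> H v -> H (a *: u + v)) ->
  exists (Q : lmodType R) (p : {linear M -> Q}),
    surjective p /\ forall x, p x = 0 <-> H x.
Proof.
move=> H0 HP; pose S : {pred M} := fun x => `[< H x >].
have SP : submod_closed S.
  by split=> [|a u v /asboolP Hu /asboolP Hv]; apply/asboolP; [|apply: HP].
pose S' : submodClosed M := HB.pack S (GRing.isSubmodClosed.Build R M S SP).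
exists (modquot S'), (modproj S'); split=> [y|x].
  exact: modproj_surj.
rewrite -(raddf0 (modproj S')); split.
  by move/modproj_eq; rewrite subr0 => /asboolP.
by move=> Hx; apply/modproj_eq; rewrite subr0; apply/asboolP.
Qed.

Lemma kernel_exists M N (f : {linear M -> N}) :
  exists (K : lmodType R) (i : {linear K -> M}), injective i /\ exact_at i f.
Proof.
have [||K [i [i_inj Ki]]] := @submodule_exists M (fun x => f x = 0).
- exact: linear0.
- by move=> a u v fu fv; rewrite linearP fu fv scaler0 add0r.
- by exists K, i; split.
Qed.

Definition ses N P M (i : {linear N -> P}) (p : {linear P -> M}) : Prop :=
  [/\ injective i, exact_at i p & surjective p].

Lemma ses_comp N P M (i : {linear N -> P}) (p : {linear P -> M}) x :
  ses i p -> p (i x) = 0.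
Proof. by case=> _ ip _; apply/ip; exists x. Qed.

Lemma ses_kernel P M (p : {linear P -> M}) : surjective p ->
  exists (K : lmodType R) (i : {linear K -> P}), ses i p.
Proof. by have [K [i [? ?]]] := kernel_exists p; exists K, i; split. Qed.

Lemma ses_cokernel N P (i : {linear N -> P}) : injective i ->
  exists (C : lmodType R) (p : {linear P -> C}), ses i p.
Proof.
move=> i_inj; have [||C [p [p_surj pi]]] :=
  @quotient_exists P (fun x => exists y, i y = x).
- by exists 0; rewrite linear0.
- by move=> a _ _ [u <-] [v <-]; exists (a *: u + v); rewrite linearP.
- by exists C, p; split=> // x; exact: pi.
Qed.

(** This is Ext^1(M, Q) = 0. Letting the kernel N vary builds in the pushout along [f]; the case N =
    Q with [f] the identity says that extensions of M by Q split. *)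
Definition ext1v M Q : Prop :=
  forall N P (i : {linear N -> P}) (p : {linear P -> M}), ses i p ->
  forall f : {linear N -> Q}, exists g : {linear P -> Q}, forall x, g (i x) = f x.

(* Any other extension receives a map from the projective one. *)
Lemma ext1v_of_one N P M Q (i : {linear N -> P}) (p : {linear P -> M}) :
  ses i p -> projective P ->
  (forall f : {linear N -> Q}, exists g : {linear P -> Q},
    forall x, g (i x) = f x) ->
  ext1v M Q.
Proof.
move=> [i_inj ip p_surj] P_proj ext K E j q [j_inj jq q_surj] f.
have [h qh] := P_proj _ _ q p q_surj.
have [n jn] : exists n : {linear N -> K}, forall x, j (n x) = h (i x).
  apply: (factor_inj (f := h \o i) j_inj) => x /=.
  by apply/jq; rewrite qh; apply/ip; exists x.
have [g0 g0i] := ext (f \o n).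
(* E is the quotient of K x P by the copy of N formed by the pairs (- n y, i y). The map given by
   [f] and [g0] vanishes there, so it descends to E. *)
have ls : linear (fun u : K * P => j u.1 + h u.2).
  by move=> a u v /=; rewrite !linearP /= scalerDr addrACA.
have lf : linear (fun u : K * P => f u.1 + g0 u.2).
  by move=> a u v /=; rewrite !linearP /= scalerDr addrACA.
have [|[k x] /= jkx|g gE] := @factor_surj _ _ _ (mklin ls) (mklin lf).
- move=> e; have [x px] := p_surj (q e).
  have [k jk] : exists k, j k = e - h x by apply/jq; rewrite linearB qh px subrr.
  by exists (k, x); rewrite mklinE /= jk subrK.
- have [y iy] : exists y, i y = x.
    by apply/ip; rewrite -qh; move/(congr1 q): jkx;
      rewrite !linearD (_ : q (j k) = 0) ?add0r ?linear0 //; apply/jq; exists k.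
  rewrite -iy g0i /= -linearD (_ : k + n y = 0) ?linear0 //.
  by apply: j_inj; rewrite linearD jn iy jkx linear0.
- by exists g => k; have := gE (k, 0); rewrite !mklinE /= !linear0 !addr0.
Qed.

End Modules.

(** * Stable equivalence and Gorenstein projective modules *)

Section Projectives.
Variable R : nzRingType.
Implicit Types M N K P Q U V W Z C : lmodType R.

Lemma projective_retract N P (s : {linear N -> P}) (r : {linear P -> N}) :
  (forall x, r (s x) = x) -> projective P -> projective N.
Proof.
move=> rs P_proj U V g f g_surj.
have [h gh] := P_proj U V g (f \o r) g_surj.
by exists (h \o s) => x /=; rewrite gh /= rs.
Qed.

Lemma linear_inl U V : linear (fun x : U => (x, 0 : V)).
Proof. by move=> a x y; congr (_, _); rewrite /= scaler0 addr0. Qed.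

Lemma linear_inr U V : linear (fun y : V => (0 : U, y)).
Proof. by move=> a x y; congr (_, _); rewrite /= scaler0 addr0. Qed.

Lemma linear_fst U V : linear (fun x : U * V => x.1).
Proof. by []. Qed.

Lemma linear_snd U V : linear (fun x : U * V => x.2).
Proof. by []. Qed.

Definition lin_inl U V := mklin (@linear_inl U V).
Definition lin_inr U V := mklin (@linear_inr U V).
Definition lin_fst U V := mklin (@linear_fst U V).
Definition lin_snd U V := mklin (@linear_snd U V).

Lemma linear_copair U V W (f : {linear U -> W}) (g : {linear V -> W}) :
  linear (fun x : U * V => f x.1 + g x.2).
Proof. by move=> a u v /=; rewrite !linearP /= scalerDr addrACA. Qed.

Lemma linear_pair U V W (f : {linear W -> U}) (g : {linear W -> V}) :
  linear (fun x : W => (f x, g x)).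
Proof. by move=> a u v /=; rewrite !linearP. Qed.

Lemma linear_prod U V U' V' (f : {linear U -> U'}) (g : {linear V -> V'}) :
  linear (fun x : U * V => (f x.1, g x.2)).
Proof. by move=> a u v /=; rewrite !linearP. Qed.

Definition lin_copair U V W f g := mklin (@linear_copair U V W f g).
Definition lin_pair U V W f g := mklin (@linear_pair U V W f g).
Definition lin_prod U V U' V' f g := mklin (@linear_prod U V U' V' f g).

Lemma projective_prod P Q :
  projective P -> projective Q -> projective (P * Q)%type.
Proof.
move=> P_proj Q_proj U V g f g_surj.
have [h1 gh1] := P_proj U V g (f \o lin_inl P Q) g_surj.
have [h2 gh2] := Q_proj U V g (f \o lin_inr P Q) g_surj.
exists (lin_copair h1 h2) => -[x y]; rewrite /=. rewrite linearD gh1 gh2 /=.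
by rewrite -linearD; congr (f (_, _)); rewrite ?addr0 ?add0r.
Qed.

Lemma projective_section P M (p : {linear P -> M}) :
  surjective p -> projective M -> exists s : {linear M -> P}, forall x, p (s x) = x.
Proof. by move=> p_surj M_proj; exact: (M_proj _ _ p idfun p_surj). Qed.

Lemma ses_retraction N P M (i : {linear N -> P}) (p : {linear P -> M})
    (s : {linear M -> P}) : ses i p -> (forall x, p (s x) = x) ->
  exists r : {linear P -> N}, forall x, i (r x) = x - s (p x).
Proof.
move=> [i_inj ip _] ps.
have lf : linear (fun x => x - s (p x)).
  by move=> a u v; rewrite /= !linearP /= scalerDr addrACA.
apply: (factor_inj (f := mklin lf) i_inj) => x; apply/ip.
by rewrite /= linearB ps subrr.
Qed.

Lemma ses_retractionK N P M (i : {linear N -> P}) (p : {linear P -> M})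
    (s : {linear M -> P}) (r : {linear P -> N}) : ses i p ->
  (forall x, i (r x) = x - s (p x)) -> forall x, r (i x) = x.
Proof.
move=> ip ir x; have [i_inj _ _] := ip; apply: i_inj.
by rewrite ir (ses_comp _ ip) linear0 subr0.
Qed.

Lemma projective_kernel N P M (i : {linear N -> P}) (p : {linear P -> M}) :
  ses i p -> projective P -> projective M -> projective N.
Proof.
move=> ip P_proj M_proj; have [_ _ p_surj] := ip.
have [s ps] := projective_section p_surj M_proj.
have [r ir] := ses_retraction ip ps.
exact: projective_retract (ses_retractionK ip ir) P_proj.
Qed.

(** Schanuel's lemma compares syzygies only up to projective summands. Since [pd_le] and [GPc] are
    invariant under this relation, no preferred resolution has to be tracked. *)
Definition stably_iso N C : Prop :=
  exists Q Z (f : {linear (N * Q)%type -> (C * Z)%type}),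
    [/\ projective Q, projective Z, injective f & surjective f].

Lemma lin_inverse U V (f : {linear U -> V}) : injective f -> surjective f ->
  exists g : {linear V -> U}, cancel f g /\ cancel g f.
Proof.
move=> f_inj f_surj; have [g fg] := factor_inj (f := idfun) f_inj f_surj.
by exists g; split=> [x|x]; rewrite ?fg //; apply: f_inj; rewrite fg.
Qed.

Lemma stably_iso_sym N C : stably_iso N C -> stably_iso C N.
Proof.
move=> [Q [Z [f [Qp Zp f_inj f_surj]]]].
have [g [fK gK]] := lin_inverse f_inj f_surj.
by exists Z, Q, g; split=> //; [exact: can_inj gK | move=> x; exists (f x)].
Qed.

Lemma projective_stably_iso N C : stably_iso N C -> projective N -> projective C.
Proof.
move=> [Q [Z [f [Qp Zp f_inj f_surj]]]] N_proj.
have [g [fK gK]] := lin_inverse f_inj f_surj.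
apply: (@projective_retract _ (N * Q)%type (g \o lin_inl C Z) (lin_fst C Z \o f)).
  by move=> x /=; rewrite gK.
exact: projective_prod.
Qed.

(* Schanuel: the pullback of [p] and [p'] is split over both [P] and [P']. *)
Lemma schanuel K P K' P' M (i : {linear K -> P}) (p : {linear P -> M})
    (i' : {linear K' -> P'}) (p' : {linear P' -> M}) :
  ses i p -> ses i' p' -> projective P -> projective P' -> stably_iso K K'.
Proof.
move=> ip ip' Pp Pp'; have [i_inj ip0 p_surj] := ip.
have [i'_inj ip0' p'_surj] := ip'.
have [a p'a] := Pp _ _ p' p p'_surj; have [b pb] := Pp' _ _ p p' p_surj.
(* The pullback is not formed. The isomorphism is the composite of its two parametrisations: (k, y)
   goes to (i k + b y, y), and (x, y) goes to (y - a x, x). *)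
pose w := lin_snd K P' \- (a \o lin_copair i b).
have [f1 i'f1] : exists f1 : {linear (K * P')%type -> K'},
    forall u, i' (f1 u) = w u.
  apply: factor_inj i'_inj _ => u; apply/ip0'; rewrite /=.
  by rewrite linearB p'a /= linearD (ses_comp _ ip) add0r pb subrr.
have i'f u : i' (f1 u) = u.2 - a (i u.1 + b u.2) by rewrite i'f1.
exists P', P, (lin_pair f1 (lin_copair i b)); split=> //.
- move=> [k y] [l z]; rewrite /= => -[f1E e].
  move: (i'f (k, y)); rewrite f1E i'f /= e => /(@addIr _ _) zy.
  by move: e; rewrite zy => /addIr/i_inj ->.
- move=> [k' x]; pose y := i' k' + a x.
  have [k ik] : exists k, i k = x - b y.
    by apply/ip0; rewrite linearB pb linearD p'a (ses_comp _ ip') add0r subrr.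
  exists (k, y); rewrite /=; congr (_, _); last by rewrite ik subrK.
  by apply: i'_inj; rewrite i'f /= ik subrK addrK.
Qed.

(** Both C x P' and C' x P are the quotient of P x P' by the diagonal copy of M. The comparison maps
    [e] and [e'] stand in for the injectivity of P and P' in the usual dual statement. *)
Lemma dual_schanuel M P C P' C' (i : {linear M -> P}) (p : {linear P -> C})
    (i' : {linear M -> P'}) (p' : {linear P' -> C'})
    (e : {linear P -> P'}) (e' : {linear P' -> P}) :
  ses i p -> ses i' p' -> projective P -> projective P' ->
  (forall x, e (i x) = i' x) -> (forall x, e' (i' x) = i x) -> stably_iso C C'.
Proof.
move=> [i_inj ip p_surj] [i'_inj ip' p'_surj] Pp Pp' ei ei'.
pose s := lin_pair (p \o lin_fst P P') (lin_snd P P' \- (e \o lin_fst P P')).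
pose t := lin_pair (p' \o lin_snd P P') (lin_fst P P' \- (e' \o lin_snd P P')).
have sE u : s u = (p u.1, u.2 - e u.1) by [].
have tE u : t u = (p' u.2, u.1 - e' u.2) by [].
have s_surj : surjective s.
  move=> [c y]; have [x px] := p_surj c; exists (x, y + e x).
  by rewrite sE /= px addrK.
have t_surj : surjective t.
  move=> [c y]; have [x px] := p'_surj c; exists (y + e' x, x).
  by rewrite tE /= px addrK.
have s0 u : s u = 0 <-> exists m, u = (i m, i' m).
  split=> [|[m ->]]; last first.
    by rewrite sE /= ei subrr; congr (_, _); apply/ip; exists m.
  rewrite sE => -[/ip[m im] /eqP]; rewrite subr_eq0 => /eqP u2.
  by exists m; rewrite im -ei im -u2; case: (u).
have t0 u : t u = 0 <-> exists m, u = (i m, i' m).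
  split=> [|[m ->]]; last first.
    by rewrite tE /= ei' subrr; congr (_, _); apply/ip'; exists m.
  rewrite tE => -[/ip'[m im] /eqP]; rewrite subr_eq0 => /eqP u2.
  by exists m; rewrite im -ei' im -u2; case: (u).
have [f fE] : exists f : {linear (C * P')%type -> (C' * P)%type},
    forall u, f (s u) = t u.
  by apply: factor_surj s_surj _ => u /s0/t0.
exists P', P, f; split=> // [x y|y].
  have [u <-] := s_surj x; have [v <-] := s_surj y; rewrite !fE => /eqP.
  rewrite -subr_eq0 -linearB => /eqP/t0/s0; rewrite linearB => /eqP.
  by rewrite subr_eq0 => /eqP.
by have [u <-] := t_surj y; exists (s u).
Qed.

(** The form of [projdim_le] that exposes one syzygy at a time, as inductions on the dimension
    require. *)
Fixpoint pd_le n M : Prop :=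
  if n is m.+1 then
    exists K P (i : {linear K -> P}) (p : {linear P -> M}),
      [/\ ses i p, projective P & pd_le m K]
  else projective M.

(** Compose P x Z -> C x Z with the isomorphism to N x Q and project to N. The kernel is an
    extension of Q by K, and it splits because Q is projective. *)
Lemma stably_iso_cover N C K P (i : {linear K -> P}) (p : {linear P -> C}) :
  stably_iso N C -> ses i p -> projective P ->
  exists K' P' (i' : {linear K' -> P'}) (p' : {linear P' -> N}),
    [/\ ses i' p', projective P' & stably_iso K' K].
Proof.
move=> [Q [Z [f [Qp Zp f_inj f_surj]]]] ip Pp; have [i_inj ip0 p_surj] := ip.
have [g [fK gK]] := lin_inverse f_inj f_surj.
have [q qE] : exists q : {linear (P * Z)%type -> (N * Q)%type},
    forall u, q u = g (p u.1, u.2).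
  by exists (g \o lin_prod p (idfun : {linear Z -> Z})).
have q_surj x : exists y, q y = x.
  by case E: (f x) => [c z]; have [y py] := p_surj c; exists (y, z); rewrite qE py -E.
have PZp := projective_prod Pp Zp.
have lp' : surjective (lin_fst N Q \o q).
  by move=> x; have [y qy] := q_surj (x, 0); exists y; rewrite /= qy.
have [K' [i' i'p]] := ses_kernel lp'.
exists K', (P * Z)%type, i', (lin_fst N Q \o q); split=> //.
have [j qj] : exists j : {linear Q -> (P * Z)%type}, forall x, q (j x) = (0, x).
  exact: Qp _ _ q (lin_inr N Q) q_surj.
have [i'_inj ip0' _] := i'p.
have [h i'h] : exists h : {linear (K * Q)%type -> K'},
    forall u, i' (h u) = (i u.1, 0) + j u.2.
  apply: (factor_inj (f := lin_copair (lin_inl P Z \o i) j) i'_inj) => u.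
  apply/ip0'; rewrite /= linearD qj qE /= (ses_comp _ ip).
  by rewrite (_ : (0, 0) = 0) // linear0 /= addr0.
apply: stably_iso_sym.
(* K x Q is already isomorphic to K'. A further copy of Q goes on both sides because [stably_iso]
   asks for a projective summand on each. *)
pose fst' := lin_fst K (Q * Q)%type; pose snd' := lin_snd K (Q * Q)%type.
pose sp := lin_pair (h \o lin_pair fst' (lin_fst Q Q \o snd')) (lin_snd Q Q \o snd').
exists (Q * Q)%type, Q, sp; split=> //; first exact: projective_prod.
- move=> [k [x a]] [l [y b]] /= [hE ->].
  have iE : (i k, 0) + j x = (i l, 0) + j y.
    by rewrite -(i'h (k, x)) -(i'h (l, y)) hE.
  have xy : x = y.
    move/(congr1 q): iE; rewrite !linearD !qj !qE /= !(ses_comp _ ip).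
    by rewrite (_ : (0, 0) = 0) // linear0 !add0r => -[].
  by move: iE; rewrite xy => /addIr[/i_inj->].
- move=> [k' b]; pose a := (q (i' k')).2.
  have qa : q (i' k') = (0, a).
    by rewrite [LHS]surjective_pairing; congr (_, _); apply/ip0'; exists k'.
  have : q (i' k' - j a) = 0 by rewrite linearB qj qa subrr.
  rewrite qE => /(congr1 f); rewrite gK linear0 => -[/ip0[k ik] y0].
  exists (k, (a, b)) => /=; congr (_, _); apply: i'_inj; rewrite i'h /=.
  apply/eqP; rewrite eq_sym -subr_eq; apply/eqP.
  by rewrite ik -[0]y0; case: (i' k') (j a) => ? ? [].
Qed.

Lemma pd_le_stable n N C : stably_iso N C -> pd_le n N -> pd_le n C.
Proof.
elim: n N C => [|n IHn] N C NC /=; first exact: projective_stably_iso.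
move=> [K [P [i [p [ip Pp Kn]]]]].
have [K' [P' [i' [p' [ip' Pp' K'K]]]]] := stably_iso_cover (stably_iso_sym NC) ip Pp.
by exists K', P', i', p'; split=> //; apply: IHn (stably_iso_sym K'K) Kn.
Qed.

Lemma pd_le_syzygy n N P M (i : {linear N -> P}) (p : {linear P -> M}) :
  ses i p -> projective P -> pd_le n.+1 M -> pd_le n N.
Proof.
move=> ip Pp [K [P' [i' [p' [ip' Pp' Kn]]]]].
exact: pd_le_stable (schanuel ip' ip Pp' Pp) Kn.
Qed.

Lemma projdim_le0 M : projdim_le 0 M -> projective M.
Proof.
move=> [P [d [e [Pp e_surj de _ P0]]]].
have e_inj : injective e.
  by apply: raddf_inj => x /de[z <-]; rewrite (P0 1%N isT z) linear0.
have [g [eK gK]] := lin_inverse e_inj e_surj.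
exact: projective_retract gK (Pp 0%N).
Qed.

Lemma projdim_leS n M : projdim_le n.+1 M ->
  exists K P (i : {linear K -> P}) (p : {linear P -> M}),
    [/\ ses i p, projective P & projdim_le n K].
Proof.
move=> [P [d [e [Pp e_surj de dd P0]]]].
have [K [i ie]] := ses_kernel e_surj; have [i_inj ie0 _] := ie.
exists K, (P 0%N), i, e; split=> //.
have [f fE] : exists f : {linear P 1%N -> K}, forall x, i (f x) = d 0%N x.
  by apply: factor_inj i_inj _ => x; apply/ie0/de; exists x.
exists (fun m => P m.+1), (fun m => d m.+1), f; split=> //.
- move=> y; have /de[x dx] : e (i y) = 0 by apply: ses_comp ie.
  by exists x; apply: i_inj; rewrite fE.
- move=> y; rewrite -dd -fE; split=> [->|]; first by rewrite linear0.
  by rewrite -(linear0 i) => /i_inj.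
- by move=> m ltm; apply: P0.
Qed.

Lemma projdim_pd_le n M : projdim_le n M -> pd_le n M.
Proof.
elim: n M => [|n IHn] M; first exact: projdim_le0.
move=> /projdim_leS[K [P [i [p [ip Pp Kn]]]]].
by exists K, P, i, p; split=> //; exact: IHn.
Qed.

End Projectives.

Section Gorenstein.
Variable R : nzRingType.
Implicit Types M N K P Q U V W Z C : lmodType R.

(** Ext^1 suffices because the condition holds for every member: exactness of Hom(P, Q) at one spot
    is the vanishing of Ext^1 for a single syzygy of the complex. *)
Definition GP_class (G : lmodType R -> Prop) : Prop := forall N, G N ->
  [/\ forall Q, projective Q -> ext1v N Q,
      exists N' P (i : {linear N -> P}) (p : {linear P -> N'}),
        [/\ ses i p, projective P & G N']
    & exists N' P (i : {linear N' -> P}) (p : {linear P -> N}),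
        [/\ ses i p, projective P & G N']].

(* The modules satisfying the following are exactly the Gorenstein projective ones. *)
Definition GPc M : Prop := exists2 G, GP_class G & G M.

Lemma GPc_class : GP_class GPc.
Proof.
move=> N [G GP GN]; have [ext [N1 [P [i [p [ip Pp G1]]]]] ] := GP N GN.
move=> [N2 [P' [i' [p' [ip' Pp' G2]]]]]; split=> //.
  by exists N1, P, i, p; split=> //; exists G.
by exists N2, P', i', p'; split=> //; exists G.
Qed.

(** Differentials are typed from [i] to [i + 1]. Writing an index as an iterated successor allows
    steps to the left without a transport along [i - 1 + 1 = i]. *)
Lemma int_succ (i : int) : exists j, i = j + 1.
Proof. by exists (i - 1); rewrite subrK. Qed.

Lemma Gorenstein_GPc M : Gorenstein_projective M -> GPc M.
Proof.
move=> [P [[Pp Pa Ph] M_P]].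
exists (fun N => exists i (j : {linear N -> P i}),
  injective j /\ exact_at j (cdiff P i)); last by exists 1.
move=> {M M_P} N [i].
(* Three steps to the left are needed: the term before the one containing N covers N, the next
   covers the kernel K of that cover, and the last carries the condition under which a map out of K
   extends. *)
have [i1 ->] := int_succ i; have [i2 ->] := int_succ i1.
have [i3 ->] := int_succ i2 => {i i1 i2} -[j [j_inj jd]].
have [p jp] : exists p : {linear P (i3 + 1 + 1) -> N},
    forall x, j (p x) = cdiff P (i3 + 1 + 1) x.
  by apply: factor_inj j_inj _ => x; apply/jd; rewrite cdiff_comp.
have p_surj : surjective p.
  move=> y; have /Pa[x dx] : cdiff P (i3 + 1 + 1 + 1) (j y) = 0.
    by apply/jd; exists y.
  by exists x; apply: j_inj; rewrite jp.
have p0 x : p x = 0 <-> cdiff P (i3 + 1 + 1) x = 0.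
  by rewrite -jp; split=> [->|]; rewrite ?linear0 // -(linear0 j) => /j_inj.
have [K [k kp]] := ses_kernel p_surj; have [k_inj kp0 _] := kp.
split=> [Q Qp||].
- apply: (ext1v_of_one kp (Pp _)) => f.
  have [e ke] : exists e : {linear P (i3 + 1) -> K},
      forall x, k (e x) = cdiff P (i3 + 1) x.
    by apply: factor_inj k_inj _ => x; apply/kp0/p0; rewrite cdiff_comp.
  have /Ph[//|g gE] : forall x, (f \o e) (cdiff P i3 x) = 0.
    move=> x /=; rewrite (_ : e _ = 0) ?linear0 //; apply: k_inj.
    by rewrite ke cdiff_comp linear0.
  exists g => x; have /kp0/p0/Pa[y dy] : exists y, k y = k x by exists x.
  by rewrite -dy gE /=; congr (f _); apply: k_inj; rewrite ke dy.
- have [L [l [l_inj ld]]] := kernel_exists (cdiff P (i3 + 1 + 1 + 1 + 1)).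
  have [q lq] : exists q : {linear P (i3 + 1 + 1 + 1) -> L},
      forall x, l (q x) = cdiff P (i3 + 1 + 1 + 1) x.
    by apply: factor_inj l_inj _ => x; apply/ld; rewrite cdiff_comp.
  exists L, (P (i3 + 1 + 1 + 1)), j, q; split=> //; last first.
    by exists (i3 + 1 + 1 + 1 + 1), l.
  split=> // [x|y].
    by rewrite -jd -lq; split=> [->|]; rewrite ?linear0 // -(linear0 l) => /l_inj.
  have /Pa[x dx] : cdiff P (i3 + 1 + 1 + 1 + 1) (l y) = 0 by apply/ld; exists y.
  by exists x; apply: l_inj; rewrite lq.
- exists K, (P (i3 + 1 + 1)), k, p; split=> //.
  exists (i3 + 1 + 1), k; split=> // y; rewrite -p0; exact: kp0.
Qed.

(** Choices of syzygy and cosyzygy can be iterated because the sigma type [S] carries membership in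
    [GPc] along. The resulting short exact sequences are spliced into a two-sided complex. *)
Lemma GPc_Gorenstein M : GPc M -> Gorenstein_projective M.
Proof.
move=> GM; pose S := {N : lmodType R | GPc N}.
pose link N N' := exists P (i : {linear N -> P}) (p : {linear P -> N'}),
  ses i p /\ projective P.
have /choice[next nextP] : forall N : S, exists N' : S, link (sval N) (sval N').
  case=> N GN; have [_ [N' [P [i [p [ip Pp GN']]]]] _] := GPc_class GN.
  by exists (exist _ N' GN'), P, i, p.
have /choice[prev prevP] : forall N : S, exists N' : S, link (sval N') (sval N).
  case=> N GN; have [_ _ [N' [P [i [p [ip Pp GN']]]]]] := GPc_class GN.
  by exists (exist _ N' GN'), P, i, p.
pose M0 : S := exist _ M GM.
pose Y (i : int) : S := match i with
  | Posz n => iter n next M0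
  | Negz n => iter n.+1 prev M0 end.
have Y_link i : link (sval (Y i)) (sval (Y (i + 1))).
  case: i => [n|[|n]].
  - by rewrite -PoszD addn1 /=; exact: nextP.
  - exact: prevP.
  - rewrite (_ : Negz n.+1 + 1 = Negz n); first exact: prevP.
    by rewrite !NegzE -[n.+2]addn1 PoszD opprD addrNK.
(* The shift places M at index 1, where [Gorenstein_projective] takes the kernel. *)
pose L i := sval (Y (i - 1)).
have L_link i : link (L i) (L (i + 1)).
  by rewrite /L addrAC; exact: Y_link.
have L_GPc i : GPc (L i) by apply: svalP.
have L1 : L 1 = M by rewrite /L subrr.
move: L L_link L_GPc L1 => {Y Y_link next nextP prev prevP M0 S GM} L L_link L_GPc L1.
have /choice[P /dep_choice[s /dep_choice[q sq]]] : forall i,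
    exists P (s : {linear L i -> P}) (q : {linear P -> L (i + 1)}),
      ses s q /\ projective P := L_link.
have [d dE] : exists d : forall i, {linear P i -> P (i + 1)},
    forall i x, d i x = s (i + 1) (q i x) by exists (fun i => s (i + 1) \o q i).
have dd i x : d (i + 1) (d i x) = 0.
  by rewrite !dE (ses_comp _ (sq (i + 1)).1) linear0.
have ker_d i x : d i x = 0 <-> exists y, s i y = x.
  have [[_ sq0 _] _] := sq i; have [[s_inj _ _] _] := sq (i + 1).
  by rewrite -sq0 dE -(linear0 (s (i + 1))); split=> [/s_inj|->].
subst M; exists (Complex dd); split; last first.
  by exists (s 1); split; [case: (sq 1) => -[] | move=> x; apply: ker_d].
split=> [i|i y|Q Qp i f] /=; first by case: (sq i).
- have [[_ _ q_surj] _] := sq i.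
  rewrite ker_d; split=> [[z <-]|[x <-]]; last by exists (q i x).
  by have [x <-] := q_surj z; exists x; rewrite dE.
- have [ses_i _] := sq i; have [_ _ q_surj] := ses_i.
  have [ses_1 _] := sq (i + 1); have [_ _ q1_surj] := ses_1.
  have [[s2_inj _ _] _] := sq (i + 1 + 1).
  split=> [fd|[g gd] x]; last by rewrite -gd dd linear0.
  (* [f] kills the image of the previous differential, so it factors through the syzygy
     [L (i + 1 + 1)]. Ext^1 vanishing for the syzygy after it extends the factor to the projective
     term. *)
  have [h hq] : exists h : {linear L (i + 1 + 1) -> Q}, forall x, h (q (i + 1) x) = f x.
    apply: factor_surj q1_surj _ => x qx0; have [_ sq0 _] := ses_1.
    have /sq0[y <-] := qx0; have [z <-] := q_surj y; rewrite -dE. exact: fd.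
  have [ext _ _] := GPc_class (L_GPc (i + 1 + 1 + 1)).
  have [g gs] := ext Q Qp _ _ _ _ (sq (i + 1 + 1)).1 h.
  by exists g => x; rewrite dE gs hq.
Qed.

(** An extension E of N pulls back along [r] to an extension K of M. The section [s] yields a map E
    -> K, through which a map extended to K returns to E. *)
Lemma ext1v_retract N M Q (s : {linear N -> M}) (r : {linear M -> N}) :
  (forall x, r (s x) = x) -> ext1v M Q -> ext1v N Q.
Proof.
move=> rs ext A E j q jq h; have [j_inj jq0 q_surj] := jq.
have [K [k [k_inj k0]]] := kernel_exists (lin_copair q (\- r)).
have k0' e m : q e = r m <-> exists y, k y = (e, m).
  by rewrite -k0 /=; split=> [->|/eqP]; rewrite ?subrr // subr_eq0 => /eqP.
have [a ka] : exists a : {linear A -> K}, forall x, k (a x) = (j x, 0).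
  apply: (factor_inj (f := lin_inl E M \o j) k_inj) => x /=.
  by apply/k0'; rewrite linear0; apply/jq0; exists x.
have [t kt] : exists t : {linear E -> K}, forall x, k (t x) = (x, s (q x)).
  apply: (factor_inj (f := lin_pair idfun (s \o q)) k_inj) => x /=.
  by apply/k0'; rewrite rs.
have [|g ga] := ext _ _ a (lin_snd E M \o k) _ h.
  split=> [x y axy|y|m].
  - by apply: j_inj; move: (ka x); rewrite axy ka => -[].
  - split=> /= [y2|[x <-]]; last by rewrite ka.
    have /jq0[x jx] : q (k y).1 = 0.
      rewrite -(linear0 r) -y2; apply/k0'; exists y.
      by rewrite -surjective_pairing.
    by exists x; apply: k_inj; rewrite ka jx -y2 -surjective_pairing.
  - have [e qe] := q_surj (r m); have /k0'[y ky] := qe.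
    by exists y; rewrite /= ky.
exists (g \o t) => x /=; rewrite -ga; congr (g _); apply: k_inj.
by rewrite kt ka (ses_comp _ jq) linear0.
Qed.

Lemma ext1v_stable N C K P V (i : {linear K -> P}) (p : {linear P -> C}) :
  ses i p -> projective P -> stably_iso N C -> ext1v C V -> ext1v N V.
Proof.
move=> ip Pp [Q [Z [f [Qp Zp f_inj f_surj]]]] ext.
have [g [fK gK]] := lin_inverse f_inj f_surj.
apply: (@ext1v_retract _ (C * Z)%type V (f \o lin_inl N Q) (lin_fst N Q \o g)).
  by move=> x /=; rewrite fK.
have ip' : ses (lin_inl P Z \o i) (lin_prod p (idfun : {linear Z -> Z})).
  have [i_inj ip0 p_surj] := ip; split.
  - by move=> x y /= [/i_inj].
  - move=> [x z]; split=> /= [[/ip0[y <-] ->]|[y [<- <-]]]; first by exists y.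
    by rewrite (ses_comp _ ip).
  - by move=> [c z]; have [x px] := p_surj c; exists (x, z); rewrite /= px.
apply: (ext1v_of_one ip' (projective_prod Pp Zp)) => h.
by have [e ei] := ext _ _ i p ip h; exists (e \o lin_fst P Z).
Qed.

(** The syzygy side is [stably_iso_cover]. For the cosyzygy, embed N in N x Q = C x Z and then in P1
    x Z. The projection onto Q extends to P1 x Z because Ext^1(C1, Q) = 0, and this identifies the
    cokernel with C1 x Q. *)
Lemma GPc_stable N C : stably_iso N C -> GPc C -> GPc N.
Proof.
move=> NC GC; exists (fun N => exists2 C, stably_iso N C & GPc C); last by exists C.
move=> {NC GC} {}N [{}C NC GC].
have [ext [C1 [P1 [i1 [p1 [ip1 Pp1 GC1]]]]] [C0 [P0 [i0 [p0 [ip0 Pp0 GC0]]]]]] :=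
  GPc_class GC.
have [K [P [i [p [ip Pp KC0]]]]] := stably_iso_cover NC ip0 Pp0.
have [Q [Z [f [Qp Zp f_inj f_surj]]]] := NC.
have [g [fK gK]] := lin_inverse f_inj f_surj.
split; last by exists K, P, i, p; split=> //; exists C0.
  by move=> V Vp; apply: ext1v_stable ip0 Pp0 NC (ext V Vp).
have [ext1 _ _] := GPc_class GC1.
have [e1 e1i] := ext1 Q Qp _ _ _ _ ip1 (lin_snd N Q \o g \o lin_inl C Z).
pose e2 := lin_snd N Q \o g \o lin_inr C Z.
have [u uE] : exists u : {linear N -> (P1 * Z)%type},
    forall n, u n = (i1 (f (n, 0)).1, (f (n, 0)).2).
  by exists (lin_prod i1 (idfun : {linear Z -> Z}) \o f \o lin_inl N Q).
have [t tE] : exists t : {linear (P1 * Z)%type -> (C1 * Q)%type},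
    forall y, t y = (p1 y.1, e1 y.1 + (g (0, y.2)).2).
  by exists (lin_pair (p1 \o lin_fst P1 Z) (lin_copair e1 e2)).
have [i1_inj ip10 p1_surj] := ip1.
have eE c z : e1 (i1 c) + (g (0, z)).2 = (g (c, z)).2.
  rewrite e1i /= -[_ + _]/((g (c, 0) + g (0, z)).2) -linearD.
  by congr (g (_, _)).2; rewrite /= ?addr0 ?add0r.
exists (C1 * Q)%type, (P1 * Z)%type, u, t; split.
- split.
  + move=> x y; rewrite !uE => -[/i1_inj fx1 fx2].
    suff /f_inj[] : f (x, 0) = f (y, 0) by [].
    by rewrite [LHS]surjective_pairing fx1 fx2 -surjective_pairing.
  + move=> [x z]; rewrite tE /=; split=> [[/ip10[c <-]]|[n]]; last first.
      rewrite uE => -[<- <-]; rewrite eE -surjective_pairing fK.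
      by rewrite (ses_comp _ ip1).
    rewrite eE => g2; exists (g (c, z)).1; rewrite uE -g2 -surjective_pairing.
    by rewrite gK.
  + move=> [c q]; have [x px] := p1_surj c.
    case E: (f (0, q - e1 x)) => [y z]; exists (x + i1 y, z).
    rewrite tE /= linearD px (ses_comp _ ip1) addr0 linearD -addrA eE -E fK /=.
    by rewrite addrC subrK.
- exact: projective_prod.
- exists C1 => //; exists Q, (Q * Q)%type.
  have lf : linear (fun x : C1 * Q * Q => (x.1.1, (x.1.2, x.2))).
    by move=> a x y.
  exists (mklin lf); split=> //; first exact: projective_prod.
    by move=> [[a b] c] [[a' b'] c'] /= [-> -> ->].
  by move=> [a [b c]]; exists (a, b, c).
Qed.

Lemma GPc_kernel K P M (i : {linear K -> P}) (p : {linear P -> M}) :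
  ses i p -> projective P -> GPc M -> GPc K.
Proof.
move=> ip Pp GM; have [_ _ [K' [P' [i' [p' [ip' Pp' GK']]]]]] := GPc_class GM.
exact: GPc_stable (schanuel ip ip' Pp Pp') GK'.
Qed.

End Gorenstein.

(** * Free modules and semisimplicity *)

Section Free.
Import monalg.
Variables (R : nzRingType) (K : choiceType).
Implicit Types U V : lmodType R.

Definition free_eval V (h : K -> V) (g : {malg R[K]}) : V :=
  \sum_(k <- msupp g) mcoeff k g *: h k.

Lemma free_evalw V (h : K -> V) (g : {malg R[K]}) (D : {fset K}) :
  (msupp g `<=` D)%fset -> free_eval h g = \sum_(k <- D) mcoeff k g *: h k.
Proof.
move=> gD; apply: big_fset_incl => // k _ /mcoeff_outdom ->; exact: scale0r.
Qed.

Lemma mcoeff_linear k : linear (mcoeff k : {malg R[K]} -> R^o).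
Proof. by move=> a u v; rewrite mcoeffD fgscaleE. Qed.

Lemma free_eval_linear V (h : K -> V) : linear (free_eval h).
Proof.
move=> a u v; pose D := (msupp u `|` msupp v `|` msupp (a *: u + v))%fset.
have uD : (msupp u `<=` D)%fset by rewrite /D -fsetUA fsubsetUl.
have vD : (msupp v `<=` D)%fset by rewrite /D [(msupp u `|` _)%fset]fsetUC -fsetUA fsubsetUl.
have wD : (msupp (a *: u + v) `<=` D)%fset by rewrite /D fsubsetUr.
rewrite !(free_evalw _ uD) (free_evalw _ vD) (free_evalw _ wD).
rewrite scaler_sumr -big_split; apply: eq_bigr => k _ /=.
by rewrite scalerA -scalerDl mcoeffD fgscaleE.
Qed.

Lemma free_evalU V (h : K -> V) k : free_eval h (mkmalgU k 1) = h k.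
Proof.
by rewrite (free_evalw _ (msuppU_le)) big_seq_fset1 mcoeffUU scale1r.
Qed.

Lemma free_projective : projective {malg R[K]}.
Proof.
move=> U V g f g_surj.
have /choice[h gh] : forall k, exists u, g u = f (mkmalgU k 1) by [].
exists (mklin (free_eval_linear h)) => x.
rewrite [x in RHS]monalgE !linear_sum; apply: eq_bigr => k _.
rewrite linearZ /= gh -linearZ; congr (f _); apply/malgP => l.
by rewrite fgscaleE !mcoeffU mulrnAr mulr1.
Qed.

Definition free_module : lmodType R := {malg R[K]}.

Definition free_basis (k : K) : free_module := mkmalgU k 1.

Definition free_coord k : {linear free_module -> R^o} := mklin (mcoeff_linear k).

Definition free_lift V (h : K -> V) : {linear free_module -> V} :=
  mklin (free_eval_linear h).

Lemma free_liftE V (h : K -> V) x : exists n (k : 'I_n -> K),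
  free_lift h x = \sum_i (free_coord (k i) x : R) *: h (k i).
Proof.
pose s := msupp x; exists (size s), (tnth (in_tuple s)).
by apply: etrans (big_tnth _ _ s predT (fun k => mcoeff k x *: h k)) _.
Qed.

End Free.

(** * Dual bases, semisimple modules and the radical *)

Section ModuleTheory.
Variable R : nzRingType.
Implicit Types M N P Q U V S : lmodType R.

(** The last clause is the finite expansion in linear coordinates that a projective module inherits
    as its dual basis. *)
Lemma free_cover M : exists P (p : {linear P -> M}),
  [/\ projective P, surjective p & forall x, exists n (y : 'I_n -> M)
    (f : 'I_n -> {linear P -> R^o}), p x = \sum_i (f i x : R) *: y i].
Proof.
exists (free_module R M), (free_lift (id : M -> M)); split.
- exact: free_projective.
- by move=> x; exists (free_basis R x); exact: free_evalU.
- move=> x; have [n [k kE]] := free_liftE (id : M -> M) x.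
  by exists n, k, (fun i => free_coord R (k i)).
Qed.

Lemma dual_basis P : projective P -> forall x, exists n (y : 'I_n -> P)
  (f : 'I_n -> {linear P -> R^o}), x = \sum_i (f i x : R) *: y i.
Proof.
move=> Pp x; have [F [p [_ p_surj pE]]] := free_cover P.
have [s ps] := projective_section p_surj Pp.
have [n [y [f fE]]] := pE (s x); exists n, y, (fun i => f i \o s).
by rewrite -[LHS]ps fE.
Qed.

Definition semisimple M : Prop := forall N (i : {linear N -> M}),
  injective i -> exists r : {linear M -> N}, forall x, r (i x) = x.

Lemma semisimple_section M N (p : {linear M -> N}) :
  semisimple M -> surjective p -> exists s : {linear N -> M}, forall x, p (s x) = x.
Proof.
move=> ssM p_surj; have [K [i ip]] := ses_kernel p_surj.
have [i_inj ip0 _] := ip; have [r ri] := ssM _ _ i_inj.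
have [|s sp] := factor_surj (f := idfun \- (i \o r)) p_surj.
  by move=> x /ip0[y <-] /=; rewrite ri subrr.
exists s => y; have [x <-] := p_surj y.
by rewrite sp linearB (ses_comp _ ip) subr0.
Qed.

(** The hypothesis supplies, beside any proper submodule H, a nonzero cyclic submodule meeting H
    trivially. Take W maximal among submodules meeting N trivially: if N + W were proper, such a
    cyclic submodule could be added to W. *)
Lemma semisimple_local M :
  (forall H : M -> Prop, H 0 -> (forall a u v, H u -> H v -> H (a *: u + v)) ->
    forall e, ~ H e -> exists2 x, x <> 0 & forall r, H (r *: x) -> r *: x = 0) ->
  semisimple M.
Proof.
move=> local N i i_inj.
pose F (W : M -> Prop) := (forall a u v, W u -> W v -> W (a *: u + v)) /\
  forall y, W (i y) -> y = 0.
have [|W [[Wlin Wi] Wmax]] := @classical_sets.Zorn_bigcup M F.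
  move=> G GF Gtot; split=> [a u v [X GX Xu] [Y GY Yv]|y [X GX]]; last first.
    by case: (GF X GX) => _; exact.
  by case: (Gtot X Y GX GY) => sXY; [exists Y => // | exists X => //];
    [case: (GF Y GY) => YP _ | case: (GF X GX) => XP _];
    (apply: YP || apply: XP) => //; exact: sXY.
(* Zorn's lemma also covers the empty chain, whose union is empty, so membership of 0 is not built
   into [F]; it follows from maximality. *)
have W0 : W 0.
  apply: contrapT => nW0.
  apply: (Wmax (fun x => W x \/ x = 0)).
    by split=> [x|e]; [left | apply/nW0/e; right].
  split=> [a u v [Wu|->] [Wv|->]|y [/Wi//|]].
  - by left; apply: Wlin.
  - by rewrite addr0; have := Wlin (-1) _ _ Wu Wu; rewrite scaleN1r addNr => /nW0.
  - by left; rewrite scaler0 add0r.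
  - by right; rewrite scaler0 addr0.
  - by rewrite -(linear0 i) => /i_inj.
have [K [k [k_inj kW]]] := submodule_exists W0 Wlin.
pose s := lin_copair i k.
have s_inj : injective s.
  apply: raddf_inj => -[y z] /= e.
  have : y = 0.
    apply: Wi; rewrite -[i y](addrK (k z)) e sub0r -scaleN1r -[_ *: _]addr0.
    by apply: Wlin => //; apply/kW; exists z.
  by move=> y0; move: e; rewrite y0 linear0 add0r -(linear0 k) => /k_inj ->.
have s_surj : surjective s.
  pose H x := exists y, s y = x.
  have HP a u v : H u -> H v -> H (a *: u + v).
    by move=> [y <-] [z <-]; exists (a *: y + z); rewrite linearP.
  move=> e; apply: contrapT => nHe.
  have [|x x0 xH] := local H _ HP e nHe; first by exists 0; rewrite linear0.
  have nWx : ~ W x.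
    move=> /kW[z kz]; apply: x0; rewrite -[x]scale1r; apply: xH.
    by exists (0, z) => /=; rewrite linear0 add0r scale1r.
  apply: (Wmax (fun y => exists w r, W w /\ y = w + r *: x)).
    split=> [y Wy|e']; first by exists y, 0; rewrite scale0r addr0.
    by apply: nWx; apply: e'; exists 0, 1; rewrite add0r scale1r.
  split=> [a u v [w [r [Ww ->]]] [w' [r' [Ww' ->]]]|y [w [r [Ww iy]]]].
    exists (a *: w + w'), (a * r + r'); split; first exact: Wlin.
    by rewrite scalerDr scalerDl scalerA addrACA.
  have rx : r *: x = 0.
    have /kW[z kz] := Ww; apply: xH; exists (y, - z) => /=.
    by rewrite linearN kz iy addrC addKr.
  by apply: Wi; rewrite iy rx addr0.
have [g [sK gK]] := lin_inverse s_inj s_surj.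
exists (lin_fst N K \o g) => x /=.
by have := sK (x, 0); rewrite /= linear0 addr0 => ->.
Qed.

(** The zero module satisfies this; a nonzero element is supplied separately wherever it matters. *)
Definition simple S : Prop := forall y z : S, y <> 0 -> exists r, z = r *: y.

Lemma rad_simple S (x : S) : simple S -> x \in rad S -> x = 0.
Proof.
move=> Ss /radP rx; apply: contrapT => x0.
have : x \in ([pred y | y == 0] : {pred S}); last by rewrite inE => /eqP.
apply: rx; split=> [||L [L0 LP] _ [w nLw] y Ly].
- split=> [|a u v]; rewrite !inE ?eqxx // => /eqP-> /eqP->.
  by rewrite scaler0 addr0.
- by exists x; rewrite inE; apply/eqP.
- rewrite inE; apply/eqP; apply: contrapT => y0; have [r wE] := Ss y w y0.
  by case/negP: nLw; rewrite wE -[_ *: _]addr0; apply: LP.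
Qed.

Lemma nonrad_simple M (x : M) : x \notin rad M ->
  exists S (p : {linear M -> S}), [/\ simple S, surjective p & p x <> 0].
Proof.
move=> /radP/existsNP[N /not_implyP[[[N0 NP] _ Nmax] /negP nNx]].
have [||S [p [p_surj pN]]] := @quotient_exists _ M (fun x => x \in N) => //.
exists S, p; split=> //; last by move/pN; exact/negP.
move=> y z y0; have [u uy] := p_surj y; have [v vz] := p_surj z.
apply: contrapT => nz.
(* [L] is N + R u. If it missed [v], maximality of N would put [u] in N. *)
pose L : {pred M} := fun w => `[< exists r, w - r *: u \in N >].
have LP w : reflect (exists r, w - r *: u \in N) (w \in L) by exact: asboolP.
apply: y0; rewrite -uy; apply/pN; apply: (Nmax L).
- split=> [|a w t /LP[r Hr] /LP[r' Hr']]; apply/LP.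
    by exists 0; rewrite scale0r subr0.
  exists (a * r + r'); rewrite scalerDl opprD addrACA -scalerA -scalerBr.
  exact: NP.
- by move=> w Nw; apply/LP; exists 0; rewrite scale0r subr0.
- exists v; apply/negP => /LP[r /pN e]; apply: nz; exists r.
  by apply/eqP; rewrite -subr_eq0 -vz -uy -linearZ -linearB e.
- by apply/LP; exists 1; rewrite scale1r subrr.
Qed.

(** An element outside rad M survives in a simple quotient of M. That quotient kills rad M, hence
    factors through Q and detects the image of the element there. *)
Lemma rad_quotient M Q (p : {linear M -> Q}) : surjective p ->
  (forall x, p x = 0 <-> x \in rad M) -> forall y, y \in rad Q -> y = 0.
Proof.
move=> p_surj pr y; have [x <-] := p_surj y => prx; apply/pr.
apply: contraT => /nonrad_simple[S [q [Ss q_surj qx]]]; case: qx.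
have [|g gp] := factor_surj (f := q) p_surj.
  by move=> z /pr/(rad_linear q); exact: rad_simple.
by rewrite -gp; apply: rad_simple => //; exact: rad_linear.
Qed.

End ModuleTheory.

Lemma field_semisimple (k : fieldType) (M : lmodType k) : semisimple M.
Proof.
apply: semisimple_local => H H0 HP e nHe; exists e.
  by move=> e0; apply: nHe; rewrite e0.
move=> r He; case: (eqVneq r 0) => [->|r0]; first by rewrite scale0r.
case: nHe; rewrite -[e]scale1r -(mulVf r0) -scalerA -[_ *: _]addr0.
exact: HP.
Qed.

Lemma field_projective (k : fieldType) (M : lmodType k) : projective M.
Proof.
move=> U V g f g_surj.
have [s gs] := semisimple_section (@field_semisimple k U) g_surj.
by exists (s \o f) => x /=; rewrite gs.
Qed.

(** * Finite-dimensional modules *)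

Section RadRegular.
Variable R : nzRingType.
Implicit Types M P : lmodType R.

Lemma scale_linear M (x : M) : linear (fun b : R^o => b *: x).
Proof. by move=> a u v; rewrite scalerDl scalerA. Qed.

Definition lin_scale M (x : M) : {linear R^o -> M} := mklin (scale_linear x).

Lemma rad_scale M (b : R) (x : M) : b \in rad R^o -> b *: x \in rad M.
Proof. by move/(rad_linear (lin_scale x)). Qed.

Lemma regular_projective : projective R^o.
Proof.
move=> U V g f g_surj; have [u gu] := g_surj (f 1).
exists (lin_scale u) => x /=.
by rewrite linearZ /= gu -linearZ; congr (f _); exact: mulr1.
Qed.

(** Dual basis coordinates are linear maps to the regular module, so they send rad P into its
    radical J. This gives the inclusion of rad P in J P. *)
Lemma rad_projective P (x : P) : projective P -> x \in rad P ->
  exists n (j : 'I_n -> R) (y : 'I_n -> P),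
    (forall i, j i \in rad R^o) /\ x = \sum_i j i *: y i.
Proof.
move=> Pp rx; have [n [y [f xE]]] := dual_basis Pp x.
by exists n, (fun i => f i x), y; split=> // i; exact: rad_linear.
Qed.

End RadRegular.

Section FiniteDimension.
Variables (k : fieldType) (B : algType k).
Implicit Types M N E K U S : lmodType B.

Definition kmod M : lmodType k := restrict_scalars (in_alg B) M.

Lemma kmodE M (c : k) (x : kmod M) : c *: x = c%:A *: (x : M).
Proof. by []. Qed.

Definition klinear M N (f : {linear M -> N}) : {linear kmod M -> kmod N}.
Proof. by refine (@mklin _ (kmod M) (kmod N) f _) => a u v; rewrite !kmodE linearP. Defined.

(* The family [e] may be redundant: this form of finite dimension passes at once
   to k-linear retracts. *)
Definition dual_base n M (e : 'I_n -> M) (c : 'I_n -> {linear kmod M -> k^o}) :=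
  forall x : M, x = \sum_i (c i x : k)%:A *: e i.

Definition kdim_le n M : Prop :=
  exists (e : 'I_n -> M) (c : 'I_n -> {linear kmod M -> k^o}), dual_base e c.

Lemma kdim_reduce n M (e : 'I_n.+1 -> M) c (l : 'I_n.+1 -> k) i0 :
  dual_base e c -> l i0 != 0 -> \sum_i (l i)%:A *: e i = 0 -> kdim_le n M.
Proof.
move=> ec l0 le.
exists (fun j => e (lift i0 j)),
  (fun j => c (lift i0 j) \- ((l (lift i0 j) / l i0) \*: c i0)) => x.
have : x = \sum_i (c i x - l i / l i0 * c i0 x : k)%:A *: e i.
  have z : \sum_i (l i / l i0 * c i0 x : k)%:A *: e i = 0.
    transitivity ((c i0 x / l i0 : k)%:A *: \sum_i (l i)%:A *: e i).
      rewrite scaler_sumr; apply: eq_bigr => i _; rewrite scalerA; congr (_ *: _).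
      by rewrite -scalerAl mul1r scalerA; congr (_ *: _); rewrite [RHS]mulrC [RHS]mulrA [RHS]mulrAC.
    by rewrite le scaler0.
  rewrite -[LHS]subr0 -[X in _ - X]z {1}[x]ec -sumrB; apply: eq_bigr => i _.
  by rewrite -!scalerBl.
rewrite (bigD1_ord i0) //= divff // mul1r subrr scale0r scale0r add0r => {1}->.
by [].
Qed.

Lemma kdim_retract n M N (s : {linear kmod N -> kmod M})
    (r : {linear kmod M -> kmod N}) :
  (forall x, r (s x) = x) -> kdim_le n M -> kdim_le n N.
Proof.
move=> rs [e [c ec]]; exists (fun i => r (e i)), (fun i => c i \o s) => x.
rewrite -{1}[x]rs {1}[s x]ec linear_sum; apply: eq_bigr => i _ /=.
by rewrite -!kmodE linearZ.
Qed.

Lemma kdim_retract_lt n M N (s : {linear kmod N -> kmod M})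
    (r : {linear kmod M -> kmod N}) (y : M) :
  (forall x, r (s x) = x) -> y <> 0 -> r y = 0 -> kdim_le n M ->
  exists2 m, (m < n)%N & kdim_le m N.
Proof.
move=> rs y0 ry [e [c ec]]; case: n e c ec => [|n] e c ec.
  by case: y0; rewrite (ec y) big_ord0.
exists n => //.
have [i0 ci0] : exists i0, c i0 y != 0 :> k.
  apply: contrapT => nc; apply: y0; rewrite (ec y) big1 // => i _.
  suff -> : (c i y : k) = 0 by rewrite !scale0r.
  by apply/eqP; apply: contraT => ci; case: nc; exists i.
pose e' i : N := r (e i).
(* The coordinates of [y], not all zero, form a relation among the [r (e i)], because their
   combination is [r y = 0]. *)
apply: (@kdim_reduce n N e' (fun i => c i \o s) (fun i => c i y) i0) => // [x|].
  rewrite -{1}[x]rs {1}[s x]ec linear_sum; apply: eq_bigr => i _ /=.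
  by rewrite -!kmodE linearZ.
rewrite -[RHS]ry [in RHS](ec y) linear_sum; apply: eq_bigr => i _ /=.
by rewrite -!kmodE linearZ.
Qed.

Lemma kdim_quotient n M N (p : {linear M -> N}) :
  surjective p -> kdim_le n M -> kdim_le n N.
Proof.
move=> p_surj; have [|s ps] := semisimple_section (@field_semisimple _ (kmod M))
  (p := klinear p); first exact: p_surj.
exact: kdim_retract ps.
Qed.

Lemma kdim_quotient_lt n M N (p : {linear M -> N}) (y : M) :
  surjective p -> y <> 0 -> p y = 0 -> kdim_le n M ->
  exists2 m, (m < n)%N & kdim_le m N.
Proof.
move=> p_surj; have [|s ps] := semisimple_section (@field_semisimple _ (kmod M))
  (p := klinear p); first exact: p_surj.
exact: kdim_retract_lt ps.
Qed.

Lemma kdim_submodule n M N (i : {linear N -> M}) :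
  injective i -> kdim_le n M -> kdim_le n N.
Proof.
move=> i_inj; have [r ri] := @field_semisimple _ (kmod M) (kmod N) (klinear i) i_inj.
exact: kdim_retract ri.
Qed.

Lemma kdim_submodule_lt n M N (i : {linear N -> M}) (y : M) :
  injective i -> (forall x, i x <> y) -> kdim_le n M ->
  exists2 m, (m < n)%N & kdim_le m N.
Proof.
move=> i_inj iy; have [r ri] := @field_semisimple _ (kmod M) (kmod N) (klinear i) i_inj.
apply: (kdim_retract_lt (y := y - i (r y)) ri).
  by move=> /eqP; rewrite subr_eq0 => /eqP/esym; exact: iy.
by rewrite -[LHS]/(r ((y : kmod M) - klinear i (r y))) linearB ri subrr.
Qed.

Lemma kdim_prod m n M N : kdim_le m M -> kdim_le n N -> kdim_le (m + n) (M * N)%type.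
Proof.
move=> [e [c ec]] [e' [c' ec']].
pose f i : (M * N)%type := match split i with inl j => (e j, 0) | inr j => (0, e' j) end.
have l1 j : linear ((fun x : M * N => c j x.1) : kmod (M * N)%type -> k^o).
  by move=> a u v; rewrite -linearP.
have l2 j : linear ((fun x : M * N => c' j x.2) : kmod (M * N)%type -> k^o).
  by move=> a u v; rewrite -linearP.
exists f, (fun i => match split i with inl j => mklin (l1 j) | inr j => mklin (l2 j) end).
move=> [x y]; rewrite big_split_ord /= /f.
under eq_bigr do rewrite (unsplitK (inl _ : 'I_m + 'I_n)) /=.
under [X in _ = _ + X]eq_bigr do rewrite (unsplitK (inr _ : 'I_m + 'I_n)) /=.
have -> : \sum_i (c i x : k)%:A *: ((e i, 0) : M * N) = (x, 0).
  have := linear_sum (lin_inl M N) (index_enum 'I_m) predT (fun i => (c i x : k)%:A *: e i).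
  rewrite -ec => /= ->; apply: eq_bigr => i _.
  by congr (_, _); rewrite /= scaler0.
have -> : \sum_i (c' i y : k)%:A *: ((0, e' i) : M * N) = (0, y).
  have := linear_sum (lin_inr M N) (index_enum 'I_n) predT (fun i => (c' i y : k)%:A *: e' i).
  rewrite -ec' => /= ->; apply: eq_bigr => i _.
  by congr (_, _); rewrite /= scaler0.
by congr (_, _); rewrite /= ?addr0 ?add0r.
Qed.

Record kbasis M := KBasis {
  kbdim : nat;
  kbvec : 'I_kbdim -> M;
  kbcoord : 'I_kbdim -> {linear kmod M -> k^o};
  kbsum : dual_base kbvec kbcoord;
  kbdual : forall i j, kbcoord j (kbvec i) = (i == j)%:R :> k
}.

Lemma kbasis_exists n M : kdim_le n M -> exists b : kbasis M, True.
Proof.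
elim: n {-2}n (leqnn n) M => [|n IHn] m lemn M [e [c ec]].
  by move: lemn e c ec; rewrite leqn0 => /eqP-> e c ec; exists (@KBasis M 0 e c ec
    (fun i => match i with Ordinal _ h => ltac:(by []) end)).
have [cd|/existsNP[i ncd]] := pselect (forall i j, c j (e i) = (i == j)%:R :> k).
  by exists (KBasis ec cd).
case: m lemn e c ec i ncd => [|m] lemn e c ec i; first by case: i.
move=> /existsNP[j ncd]; apply: (IHn m) => //.
apply: (@kdim_reduce m M e c (fun j => c j (e i) - (i == j)%:R : k) j) => //.
  by rewrite subr_eq0; exact/eqP.
under eq_bigr do rewrite !scalerBl.
rewrite sumrB -ec (bigD1 i) //= eqxx !scale1r big1 ?addr0 ?subrr // => l.
by rewrite eq_sym => /negPf->; rewrite !scale0r.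
Qed.

Lemma kdim_kbasis M (b : kbasis M) : kdim_le (kbdim b) M.
Proof. by exists (@kbvec M b), (@kbcoord M b); exact: kbsum. Qed.

Lemma simple_quotient n M (x : M) : kdim_le n M -> x <> 0 ->
  exists S (p : {linear M -> S}), [/\ simple S, surjective p & exists y, p y <> 0].
Proof.
elim/ltn_ind: n M x => n IHn M x Mn x0.
have [Ms|nMs] := pselect (simple M).
  by exists M, idfun; split=> //; [move=> y; exists y | exists x].
have [y [z [y0 nz]]] : exists y z : M, y <> 0 /\ forall r, z <> r *: y.
  apply: contrapT => H; apply: nMs => y z y0; apply: contrapT => nr; apply: H.
  by exists y, z; split=> // r zE; apply: nr; exists r.
have [||Q [p [p_surj pE]]] := @quotient_exists _ M (fun w => exists r, w = r *: y).
- by exists 0; rewrite scale0r.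
- move=> a _ _ [r ->] [r' ->]; exists (a * r + r').
  by rewrite scalerDl scalerA.
have py : p y = 0 by apply/pE; exists 1; rewrite scale1r.
have [m ltmn Qm] := kdim_quotient_lt p_surj y0 py Mn.
have [|S [q [Ss q_surj [w qw]]]] := IHn m ltmn Q (p z) Qm.
  by move=> /pE[r]; exact: nz.
exists S, (q \o p); split=> //.
  by move=> s; have [v <-] := q_surj s; have [u <-] := p_surj v; exists u.
by have [u pu] := p_surj w; exists u; rewrite /= pu.
Qed.

Lemma rad_proper n M (x : M) : kdim_le n M -> x <> 0 ->
  exists y : M, y \notin rad M.
Proof.
move=> Mn x0; have [S [p [Ss _ [y py]]]] := simple_quotient Mn x0.
by exists y; apply/negP => /(rad_linear p)/(rad_simple Ss).
Qed.

Lemma rad_submodule M : exists N (i : {linear N -> M}),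
  injective i /\ forall x, x \in rad M <-> exists y, i y = x.
Proof.
apply: submodule_exists; first exact: (@rpred0 _ (rad M)).
by move=> a u v ru rv; apply: (@rpredD _ (rad M)) => //; apply: (@rpredZ _ _ (rad M)).
Qed.

Lemma kdim_rad n M N (i : {linear N -> M}) (x : M) : injective i ->
  (forall x, x \in rad M <-> exists y, i y = x) -> kdim_le n M -> x <> 0 ->
  exists2 m, (m < n)%N & kdim_le m N.
Proof.
move=> i_inj ri Mn x0; have [y nry] := rad_proper Mn x0.
apply: (kdim_submodule_lt (y := y) i_inj _ Mn) => z iz; case/negP: nry.
by apply/ri; exists z.
Qed.

(** Each passage to the radical lowers the dimension. The list is peeled from its end because
    [foldr] lets the last entry act first. *)
Lemma rad_nilpotent n M (s : seq B) (x : M) : kdim_le n M -> (n <= size s)%N ->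
  {in s, forall b, b \in rad B^o} -> foldr (fun b y => b *: y) x s = 0.
Proof.
elim/ltn_ind: n M s x => n IHn M s x Mn.
have fold0 t : foldr (fun b (y : M) => b *: y) 0 t = 0.
  by elim: t => //= b t ->; rewrite scaler0.
have [-> //|/eqP x0] := eqVneq x 0.
have [N [i [i_inj iE]]] := rad_submodule M.
have [m ltmn Nm] := kdim_rad i_inj iE Mn x0.
case/lastP: s => [|s b]; first by rewrite leqNgt (leq_trans _ ltmn).
rewrite size_rcons foldr_rcons => len sJ.
have /iE[y <-] : b *: x \in rad M by apply/rad_scale/sJ; rewrite mem_rcons mem_head.
have -> : foldr (fun b y => b *: y) (i y) s = i (foldr (fun b y => b *: y) y s).
  by elim: (s) => //= c t ->; rewrite linearZ.
rewrite (IHn m ltmn N) ?linear0 // ?(leq_trans ltmn) //.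
  by rewrite -ltnS (leq_trans ltmn).
by move=> c cs; apply: sJ; rewrite mem_rcons inE cs orbT.
Qed.

(** A simple quotient [p] of E that is nonzero on U cuts out a smaller K in U. By induction K has a
    retraction [r] from E, and the pair (r, p) restricts to an isomorphism of U with K x S; its
    inverse on U gives the retraction. *)
Lemma radical_zero_splits n E U (i : {linear U -> E}) :
  (forall y, y \in rad E -> y = 0) -> kdim_le n U -> injective i ->
  exists r : {linear E -> U}, forall x, r (i x) = x.
Proof.
move=> rE; elim/ltn_ind: n U i => n IHn U i Un i_inj.
have [U0|/existsNP[u u0]] := pselect (forall u : U, u = 0).
  by exists \0 => x; rewrite [RHS]U0.
have [|S [p [Ss p_surj piu]]] := @nonrad_simple _ E (i u).
  by apply/negP => /rE; rewrite -(linear0 i) => /i_inj.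
have [K [t [t_inj t0]]] := kernel_exists (p \o i).
have [|m ltmn Km] := kdim_submodule_lt (y := u) t_inj _ Un.
  by move=> y ty; apply: piu; apply/t0; exists y.
have [|r rk] := IHn m ltmn K (i \o t) Km; first exact: inj_comp.
pose g := lin_pair r p \o i.
have g_inj : injective g.
  apply: raddf_inj => x [rx px]; have /t0[y ty] : (p \o i) x = 0 := px.
  by rewrite -ty -(rk y) /= ty rx linear0.
have g_surj : surjective g.
  move=> [y z]; have [a az] := Ss (p (i u)) (z - 0) piu.
  have pt w : p (i (t w)) = 0 by apply/t0; exists w.
  move wE: (y - r (i (a *: u))) => w; exists (a *: u + t w); rewrite /g /=.
  rewrite !linearD pt addr0 (rk w) -wE addrC subrK; congr (_, _).
  by rewrite !linearZ /= -az subr0.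
have [h [gK hK]] := lin_inverse g_inj g_surj.
by exists (h \o lin_pair r p) => x; apply: gK.
Qed.

End FiniteDimension.

Arguments kbvec {k B M} _ _.
Arguments kbcoord {k B M} _ _.
Arguments kbsum {k B M} _ _.
Arguments kbdual {k B M} _ _ _.

(** * The dual of B / rad B *)

Section Semisimplicity.
Variables (k : fieldType) (B : falgType k).
Implicit Types M N E F K U S Q : lmodType B.

Lemma kdim_regular : kdim_le (\dim {:B}) B^o.
Proof.
pose e i : B^o := (vbasis {:B})`_i.
have lc i : linear (coord (vbasis {:B}) i : kmod B^o -> k^o).
  by move=> a u v; rewrite -[a *: u]/(a%:A * u : B) mulr_algl linearP.
exists e, (fun i => mklin (lc i)) => x.
rewrite {1}(coord_vbasis (memvf x)); apply: eq_bigr => i _ /=.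
by rewrite -[LHS]mulr_algl.
Qed.

Lemma kdim_cover n M : kdim_le n M -> exists F (p : {linear F -> M}),
  [/\ projective F, surjective p & exists m, kdim_le m F].
Proof.
move=> [e [c ec]].
have Bp := @regular_projective B.
have cover j (x : 'I_j -> M) : exists F (p : {linear F -> M}),
    [/\ projective F, forall i, exists y, p y = x i & exists m, kdim_le m F].
  elim: j x => [|j IHj] x.
    exists B^o, \0; split=> //; first by case.
    by exists (\dim {:B}); exact: kdim_regular.
  have [F [p [Fp px [m Fm]]]] := IHj (fun i => x (lift ord0 i)).
  exists (F * B^o)%type, (lin_copair p (lin_scale (x ord0))); split.
  - exact: projective_prod.
  - move=> i; case: (unliftP ord0 i) => [i' ->|->].
      by have [y py] := px i'; exists (y, 0); rewrite /= py scale0r addr0.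
    by exists (0, 1); rewrite /= linear0 scale1r add0r.
  - by exists (m + \dim {:B})%N; apply: kdim_prod Fm kdim_regular.
have [F [p [Fp pe Fm]]] := cover n e; exists F, p; split=> // x.
have /choice[y py] := pe.
exists (\sum_i (c i x : k)%:A *: y i); rewrite linear_sum [RHS]ec.
by apply: eq_bigr => i _; rewrite linearZ /= py.
Qed.

Lemma radical_quotient : exists S (q : {linear B^o -> S}),
  [/\ surjective q, forall b, q b = 0 <-> b \in rad B^o,
      forall y, y \in rad S -> y = 0 & exists n, kdim_le n S].
Proof.
have [||S [q [q_surj qE]]] := @quotient_exists B B^o (fun b => b \in rad B^o).
- exact: (@rpred0 _ (rad B^o)).
- by move=> a u v ru rv; apply: (@rpredD _ (rad B^o)) => //; apply: (@rpredZ _ _ (rad B^o)).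
exists S, q; split=> //; first exact: rad_quotient qE.
by exists (\dim {:B}); exact: kdim_quotient q_surj kdim_regular.
Qed.

Definition rad_killed E := forall b (x : E), b \in rad B^o -> b *: x = 0.

(* Every cyclic submodule is a quotient of the semisimple module B / rad B. *)
Lemma semisimple_killed E : rad_killed E -> semisimple E.
Proof.
move=> JE; have [S [q [q_surj qE radS [n Sn]]]] := radical_quotient.
apply: semisimple_local => H H0 HP e nHe.
have [|f fq] := factor_surj (f := lin_scale e) q_surj.
  by move=> b /qE; exact: JE.
have [||U [i [i_inj iE]]] := @submodule_exists _ S (fun s => H (f s)).
- by rewrite linear0.
- by move=> a u v Hu Hv; rewrite linearP; exact: HP.
have [r ri] := radical_zero_splits radS (kdim_submodule i_inj Sn) i_inj.
(* [U] is the preimage of H in B / J, and [s] is the component of 1 in a complement of it. Hence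
   multiples of [f s] meet H only in 0, and [f s = 0] would put [e] in H. *)
pose s := q 1 - i (r (q 1)).
have fsE : f s = e - f (i (r (q 1))) by rewrite linearB fq /= scale1r.
have Hi : H (f (i (r (q 1)))) by apply/iE; exists (r (q 1)).
exists (f s).
  rewrite fsE => /eqP; rewrite subr_eq0 => /eqP eE; apply: nHe.
  by rewrite eE.
move=> b; rewrite -linearZ => /iE[u iu].
suff -> : b *: s = 0 by rewrite linear0.
have : r (i u) = 0 by rewrite iu linearZ /= linearB ri subrr scaler0.
by rewrite ri => u0; rewrite -iu u0 linear0.
Qed.

Lemma rad_killed_quotient M Q (p : {linear M -> Q}) : surjective p ->
  (forall x, x \in rad M -> p x = 0) -> rad_killed Q.
Proof.
move=> p_surj pr b y Jb; have [x <-] := p_surj y.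
by rewrite -linearZ; apply/pr/rad_scale.
Qed.

End Semisimplicity.

Record action (R : nzRingType) (W : zmodType) := Action {
  act :> R -> W -> W;
  actA : forall a b x, act a (act b x) = act (a * b) x;
  act1 : left_id 1 act;
  actDr : right_distributive act +%R;
  actDl : forall x, {morph act^~ x : a b / a + b}
}.

(** An alias keeps the new module structure apart from those that [W] already carries. *)
Definition acted (R : nzRingType) (W : zmodType) (a : action R W) : Type := W.

Section Acted.
Variables (R : nzRingType) (W : zmodType) (a : action R W).

HB.instance Definition _ := GRing.Zmodule.on (acted a).
HB.instance Definition _ := GRing.Zmodule_isLmodule.Build R (acted a)
  (@actA R W a) (@act1 R W a) (@actDr R W a) (@actDl R W a).

Lemma acted_scaleE b (x : acted a) : b *: x = a b x.
Proof. by []. Qed.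

End Acted.

(* The left module Hom_k(B / rad B, k): [c] are coordinates on B / rad B with
   respect to the images of [b], and [pi i] is evaluation at [b i]. *)
Section DualTop.
Variables (k : fieldType) (B : falgType k).

Record radical_coordinates := RadicalCoordinates {
  rcdim : nat;
  rcvec : 'I_rcdim -> B;
  rccoord : 'I_rcdim -> {linear kmod B^o -> k^o};
  rcdual : forall i j, rccoord j (rcvec i : B^o) = (i == j)%:R :> k;
  rcrad : forall b : B, b \in rad B^o <-> forall i, rccoord i (b : B^o) = 0 :> k
}.

Lemma radical_coordinates_exist : exists r : radical_coordinates, True.
Proof.
have [S [q [q_surj qE _ [n Sn]]]] := radical_quotient B.
have [[m e c ec cd] _] := kbasis_exists Sn.
have /choice[b qb] : forall i, exists b, q b = e i by move=> i; exact: q_surj.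
unshelve eexists (@RadicalCoordinates m b (fun i => c i \o klinear q) _ _) => //.
  by move=> i j; rewrite /= qb.
move=> x; rewrite -qE; split=> [qx i|cx]; first by rewrite /= qx linear0.
by rewrite [LHS](ec (q x)) big1 // => i _; rewrite [X in X%:A]cx scale0r scale0r.
Qed.

Variable r : radical_coordinates.
Notation d := (rcdim r).
Notation b := (@rcvec r).
Notation c := (@rccoord r).

(** Right multiplication by [y] is an endomorphism of the left regular module, so it preserves the
    radical. *)
Lemma rad_mulr (x y : B) : x \in rad B^o -> x * y \in rad B^o.
Proof. exact: rad_scale. Qed.

Lemma rad_mull (x y : B) : y \in rad B^o -> x * y \in rad B^o.
Proof. exact: (@rpredZ _ _ (rad B^o)). Qed.

Lemma rccoord_rad i (x : B) : x \in rad B^o -> c i (x : B^o) = 0 :> k.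
Proof. by move/rcrad. Qed.

Lemma rccoordZ j (a : k) (x : B) : c j (a%:A * x : B^o) = a * (c j (x : B^o) : k) :> k.
Proof. exact: (linearZ_LR (c j) a (x : kmod B^o)). Qed.

Lemma rcsum (x : B) : x - \sum_i (c i (x : B^o) : k)%:A * b i \in rad B^o.
Proof.
pose x' : kmod B^o := \sum_i (c i (x : B^o) : k) *: (b i : kmod B^o).
apply/rcrad => j; rewrite -[LHS]/(c j ((x : kmod B^o) - x')) linearB linear_sum.
rewrite (bigD1 j) //= big1 => [|i /negPf ij].
  by rewrite linearZ /= rcdual eqxx addr0 [_ *: _]mulr1 subrr.
by rewrite linearZ /= rcdual ij [LHS]mulr0.
Qed.

Lemma rcM l (x y : B) :
  c l (x * y : B^o) = \sum_i (c i (x : B^o) : k) * (c l (b i * y : B^o) : k) :> k.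
Proof.
have /(rad_mulr y)/(rccoord_rad l) := rcsum x.
rewrite mulrBl -[LHS]/(c l ((x * y : kmod B^o) - (_ * y : kmod B^o))) linearB.
move/eqP; rewrite subr_eq0 => /eqP ->.
rewrite mulr_suml -[LHS]/(c l (\sum_i (_ : kmod B^o))) linear_sum.
by apply: eq_bigr => i _; rewrite -[(_ * _ * y : B)]mulrA rccoordZ.
Qed.

(** A functional is stored through its values at the [b i]. The formula is (y f)(x) = f(x y) at x =
    [b i], with [b i * y] expanded modulo J. *)
Definition dual_act (y : B) (f : {ffun 'I_d -> k}) : {ffun 'I_d -> k} :=
  [ffun i => \sum_j (c j (b i * y : B^o) : k) * f j].

Lemma dual_actA x y f : dual_act x (dual_act y f) = dual_act (x * y) f.
Proof.
apply/ffunP => i; rewrite !ffunE.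
under eq_bigr do rewrite ffunE mulr_sumr.
rewrite exchange_big; apply: eq_bigr => l _ /=.
by rewrite mulrA rcM mulr_suml; apply: eq_bigr => j _; rewrite mulrA.
Qed.

Lemma dual_act1 : left_id 1 dual_act.
Proof.
move=> f; apply/ffunP => i; rewrite !ffunE (bigD1 i) //= big1 => [|j ji].
  by rewrite mulr1 rcdual eqxx mul1r addr0.
by rewrite mulr1 rcdual eq_sym (negPf ji) mul0r.
Qed.

Lemma dual_actDr : right_distributive dual_act +%R.
Proof.
move=> y f g; apply/ffunP => i; rewrite !ffunE -big_split; apply: eq_bigr => j _.
by rewrite ffunE mulrDr.
Qed.

Lemma dual_actDl f : {morph dual_act^~ f : x y / x + y}.
Proof.
move=> x y; apply/ffunP => i; rewrite !ffunE -big_split; apply: eq_bigr => j _ /=.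
rewrite mulrDr -mulrDl; congr (_ * _).
exact: (linearD (c j) (b i * x : kmod B^o) (b i * y : kmod B^o)).
Qed.

Definition dual_top : lmodType B :=
  acted (Action dual_actA dual_act1 dual_actDr dual_actDl).

Lemma dual_topE y (f : dual_top) i :
  (y *: f : {ffun 'I_d -> k}) i = \sum_j (c j (b i * y : B^o) : k) * f j.
Proof. by rewrite [LHS]ffunE. Qed.

Lemma dual_top_scale (a : k) (f : dual_top) i :
  (a%:A *: f : {ffun 'I_d -> k}) i = a * f i.
Proof.
rewrite dual_topE (bigD1 i) //= big1 => [|j ji].
  by rewrite mulr_algr -mulr_algl rccoordZ rcdual eqxx mulr1 addr0.
by rewrite mulr_algr -mulr_algl rccoordZ rcdual eq_sym (negPf ji) mulr0 mul0r.
Qed.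

Lemma dual_top_killed : rad_killed dual_top.
Proof.
move=> y f Jy; apply/ffunP => i; rewrite dual_topE big1 ?ffunE // => j _.
by rewrite rccoord_rad ?mul0r //; exact: rad_mull.
Qed.

Lemma dual_coord_linear i :
  linear ((fun f : {ffun 'I_d -> k} => f i) : kmod dual_top -> k^o).
Proof. by move=> a f g; rewrite ffunE dual_top_scale. Qed.

Definition dual_coord i := mklin (dual_coord_linear i).

Definition dual_vec i : dual_top := [ffun j => (i == j)%:R] : {ffun 'I_d -> k}.

Lemma dual_sum : dual_base dual_vec dual_coord.
Proof.
move=> f; apply/ffunP => j; rewrite sum_ffunE (bigD1 j) //= big1 => [|i ij].
  by rewrite addr0 dual_top_scale ffunE eqxx mulr1.
by rewrite dual_top_scale ffunE (negPf ij) mulr0.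
Qed.

Lemma dual_dual i j : dual_coord j (dual_vec i) = (i == j)%:R :> k.
Proof. by rewrite /= ffunE. Qed.

Definition dual_kbasis : kbasis dual_top := KBasis dual_sum dual_dual.

(* The canonical map M -> Hom_k (B / rad B, M) splits by semisimplicity. *)
Lemma dual_top_cogenerates (M : lmodType B) (e : kbasis M) : rad_killed M ->
  exists (f : 'I_(kbdim e) -> {linear M -> dual_top})
    (g : 'I_(kbdim e) -> {linear dual_top -> M}),
    forall x, \sum_l g l (f l x) = x.
Proof.
move=> JM.
have cE l (y : B) (x : M) : kbcoord e l (y *: x : M) =
    \sum_j (c j (y : B^o) : k) * (kbcoord e l (b j *: x : M) : k) :> k.
  have := JM _ x (rcsum y); rewrite scalerBl => /eqP; rewrite subr_eq0 => /eqP->.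
  rewrite scaler_suml -[LHS]/(kbcoord e l (\sum_j (_ : kmod M))) linear_sum.
  apply: eq_bigr => j _; rewrite -scalerA.
  exact: (linearZ_LR (kbcoord e l) _ ((b j *: x : M) : kmod M)).
(* [f l x] encodes the functional sending y to the l-th coordinate of y x. Evaluation at y = 1
   recovers the coordinates of x, so the [f l] are jointly injective. *)
pose f l (x : M) : {ffun 'I_d -> k} := [ffun i => kbcoord e l (b i *: x : M) : k].
have lf l : linear (f l : M -> dual_top).
  move=> y u v; apply/ffunP => i; rewrite ffunE.
  have -> : (y *: (f l u : dual_top) + f l v : dual_top) =
      [ffun i => (y *: (f l u : dual_top) : {ffun 'I_d -> k}) i + f l v i] :> {ffun 'I_d -> k}.
    by apply/ffunP => i'; rewrite !ffunE.
  rewrite ffunE dual_topE scalerDr scalerA.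
  rewrite [kbcoord _ _ _](linearD (kbcoord e l) (_ : kmod M) (_ : kmod M)) cE ffunE.
  by congr (_ + _); apply: eq_bigr => j _; rewrite ffunE.
have lF : linear (fun x => [ffun l => f l x] : {ffun 'I_(kbdim e) -> dual_top}).
  by move=> y u v; apply/ffunP => l; rewrite !ffunE; exact: lf.
have F_inj : injective (mklin lF).
  apply: raddf_inj => x /ffunP Fx; rewrite [LHS](kbsum e x) big1 // => l _.
  suff -> : kbcoord e l (x : kmod M) = 0 :> k by rewrite !scale0r.
  rewrite -[x in LHS]scale1r cE big1 // => j _.
  have := Fx l; rewrite !ffunE => /ffunP/(_ j); rewrite !ffunE => ->.
  by rewrite mulr0.
have JD : rad_killed {ffun 'I_(kbdim e) -> dual_top}.
  by move=> y w Jy; apply/ffunP => l; rewrite !ffunE; exact: dual_top_killed.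
have [t tF] := semisimple_killed JD F_inj.
have ls l : linear (fun w : dual_top =>
    [ffun l' => if l' == l then w else 0] : {ffun 'I_(kbdim e) -> dual_top}).
  move=> y u v; apply/ffunP => l'; rewrite !ffunE.
  by case: eqP => // _; rewrite scaler0 addr0.
exists (fun l => mklin (lf l)), (fun l => t \o mklin (ls l)) => x.
rewrite -[RHS]tF -linear_sum; congr (t _); apply/ffunP => l.
rewrite sum_ffunE (bigD1 l) //= big1 => [|l' /negPf ll'].
  by rewrite !ffunE eqxx addr0.
by rewrite ffunE eq_sym ll'.
Qed.

End DualTop.

Arguments rcvec {k B} _ _.
Arguments rccoord {k B} _ _.

(** * Tensor products over the ground field *)

Section TensorCoordinates.
Variables (k : fieldType) (A B : algType k) (T : tensor_product A B).
Variable rB : kbasis (B^o : lmodType B).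
Notation b := (@kbvec _ _ _ rB).
Notation c := (@kbcoord _ _ _ rB).

Lemma kbcoordZ i x (y : B) : c i (x *: y : B) = x * (c i (y : B) : k) :> k.
Proof. by rewrite -mulr_algl; exact: (linearZ_LR (c i) x (y : kmod B^o)). Qed.

Lemma kbcoordD i (x y : B) : c i (x + y : B) = (c i (x : B) : k) + c i (y : B) :> k.
Proof. exact: (linearD (c i) (x : kmod B^o) (y : kmod B^o)). Qed.

Lemma kbregular_sum (x : B) : x = \sum_i (c i (x : B) : k) *: b i.
Proof.
rewrite {1}(kbsum rB x); apply: eq_bigr => i _.
by rewrite -[RHS]mulr_algl.
Qed.

Lemma tens_coord_exists i : exists g : {linear T -> A},
  forall x y, g (tensl T x * tensr T y) = (c i (y : B) : k) *: x.
Proof.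
pose f (x : A) (y : B) : A := (c i (y : B) : k) *: x.
have fP : bilinear_for *:%R *:%R f.
  split=> [y|x] a u v; rewrite /f.
    by rewrite scalerDr scalerA mulrC -scalerA.
  by rewrite kbcoordD kbcoordZ scalerDl -scalerA.
pose f' : {bilinear A -> B -> A} :=
  HB.pack f (bilinear_isBilinear.Build k A B A *:%R *:%R f fP).
by have [g gE] := tens_lift T f'; exists g.
Qed.

Definition tens_coord i : {linear T -> A} := projT1 (cid (tens_coord_exists i)).

Lemma tens_coordE i x y :
  tens_coord i (tensl T x * tensr T y) = (c i (y : B) : k) *: x.
Proof. exact: (projT2 (cid (tens_coord_exists i))). Qed.

(** Both sides are k-linear in [t], so the uniqueness clause of the tensor product reduces the claim
    to pure tensors. The basis of B thus generates T over A. *)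
Lemma tens_span t : t = \sum_i tensl T (tens_coord i t) * tensr T (b i).
Proof.
have lg : linear (fun t : T => \sum_i tensl T (tens_coord i t) * tensr T (b i)).
  move=> a u v; rewrite scaler_sumr -big_split; apply: eq_bigr => i _ /=.
  by rewrite !linearP mulrDl scalerAl.
apply: (@tens_uniq _ _ _ T T idfun (@mklin k T T _ lg)) => x y /=.
rewrite {1}(kbregular_sum y) linear_sum mulr_sumr; apply: eq_bigr => i _.
by rewrite tens_coordE !linearZ /= -scalerAr scalerAl.
Qed.

Lemma tens_ind (H : T -> Prop) : (forall s t, H s -> H t -> H (s + t)) ->
  H 0 -> (forall x y, H (tensl T x * tensr T y)) -> forall t, H t.
Proof.
by move=> HD H0 Hxy t; rewrite (tens_span t); apply: (big_ind H).
Qed.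

Lemma tens_mul x y x' y' : (tensl T x * tensr T y) * (tensl T x' * tensr T y') =
  tensl T (x * x') * tensr T (y * y').
Proof.
by rewrite !rmorphM -!mulrA; congr (_ * _); rewrite !mulrA tens_comm.
Qed.

Lemma tens_linear (X Y : lmodType T) (f : X -> Y) :
  (forall x y, f (x + y) = f x + f y) ->
  (forall a x, f (tensl T a *: x) = tensl T a *: f x) ->
  (forall y x, f (tensr T y *: x) = tensr T y *: f x) -> linear f.
Proof.
move=> fD fl fr t u v; rewrite fD; congr (_ + _).
elim/tens_ind: t => [s t IHs IHt||x y].
- by rewrite !scalerDl fD IHs IHt.
- by rewrite !scale0r; apply: (addrI (f 0)); rewrite -fD !addr0.
- by rewrite -!scalerA fl fr.
Qed.

(** Linearity of [bact y] over A expresses that the two actions commute, and [bact_scalar] that they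
    agree on k: these are the data of a module over A (x) B. *)
Record bimodule (W : lmodType A) := Bimodule {
  bact : B -> {linear W -> W};
  bactD : forall x y w, bact (x + y) w = bact x w + bact y w;
  bactM : forall x y w, bact (x * y) w = bact x (bact y w);
  bact_scalar : forall (x : k) w, bact x%:A w = x%:A *: w
}.

Section TensorAction.
Variables (W : lmodType A) (be : bimodule W).

Definition tact (t : T) (w : W) : W := \sum_i tens_coord i t *: bact be (b i) w.

Lemma bact0 w : bact be 0 w = 0.
Proof. by rewrite -(scale0r 1) bact_scalar !scale0r. Qed.

Lemma bact1 w : bact be 1 w = w.
Proof. by rewrite -(scale1r 1) bact_scalar !scale1r. Qed.

Lemma tact_pure x y w : tact (tensl T x * tensr T y) w = x *: bact be y w.
Proof.
rewrite {2}(kbregular_sum y).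
rewrite (big_morph (fun z => bact be z w) (fun u v => bactD be u v w) (bact0 w)).
rewrite scaler_sumr; apply: eq_bigr => i _; rewrite tens_coordE.
by rewrite -[X in _ = _ *: bact be X w]mulr_algl bactM bact_scalar scalerA mulr_algr.
Qed.

Lemma tactDl w : {morph tact^~ w : s t / s + t}.
Proof.
move=> s t; rewrite /tact -big_split; apply: eq_bigr => i _ /=.
by rewrite linearD scalerDl.
Qed.

Lemma tactDr : right_distributive tact +%R.
Proof.
move=> t v w; rewrite /tact -big_split; apply: eq_bigr => i _ /=.
by rewrite linearD scalerDr.
Qed.

Lemma tact0l w : tact 0 w = 0.
Proof. by apply: (addrI (tact 0 w)); rewrite -tactDl !addr0. Qed.

Lemma tact0r t : tact t 0 = 0.
Proof. by apply: (addrI (tact t 0)); rewrite -tactDr !addr0. Qed.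

Lemma tactA s t w : tact s (tact t w) = tact (s * t) w.
Proof.
elim/tens_ind: s => [s s' IHs IHs'||x y].
- by rewrite mulrDl !tactDl IHs IHs'.
- by rewrite mul0r !tact0l.
elim/tens_ind: t => [t t' IHt IHt'||x' y'].
- by rewrite mulrDr !tactDl tactDr IHt IHt'.
- by rewrite mulr0 tact0l tact0r.
- by rewrite tens_mul !tact_pure linearZ scalerA bactM.
Qed.

Lemma tact1 : left_id 1 tact.
Proof.
move=> w; rewrite -(mulr1 1) -{1}(rmorph1 (tensl T)) -(rmorph1 (tensr T)).
by rewrite tact_pure bact1 scale1r.
Qed.

Definition tmod : lmodType T := acted (Action tactA tact1 tactDr tactDl).

Lemma tmod_tensl x (w : tmod) : tensl T x *: w = x *: (w : W) :> W.
Proof. by rewrite acted_scaleE -[tensl T x]mulr1 -(rmorph1 (tensr T)) [LHS]tact_pure bact1. Qed.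

Lemma tmod_tensr y (w : tmod) : tensr T y *: w = bact be y (w : W) :> W.
Proof.
rewrite acted_scaleE -[tensr T y]mul1r -(rmorph1 (tensl T)) [LHS]tact_pure.
by rewrite scale1r.
Qed.

End TensorAction.

(** * The module Q (x) M for finite-dimensional M *)

Section TensorModule.
Variables (Q : lmodType A).
Implicit Types M N : lmodType B.

(* The functions on a basis of M with values in Q represent Q (x) M. *)
Definition tpure M (e : kbasis M) (q : Q) (x : M) : {ffun 'I_(kbdim e) -> Q} :=
  [ffun j => (kbcoord e j (x : kmod M) : k)%:A *: q].

Lemma tpureDr M (e : kbasis M) q x y :
  tpure e q (x + y) = tpure e q x + tpure e q y.
Proof.
apply/ffunP => j; rewrite !ffunE -scalerDl -scalerDl; congr (_%:A *: _).
exact: (linearD (kbcoord e j) (x : kmod M) (y : kmod M)).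
Qed.

Lemma tpure_linear M (e : kbasis M) x : linear (tpure e ^~ x).
Proof.
move=> a p q; apply/ffunP => j; rewrite !ffunE scalerDr !scalerA.
by rewrite mulr_algl mulr_algr.
Qed.

Lemma tpureZ M (e : kbasis M) a q x :
  tpure e q (a%:A *: x) = tpure e (a%:A *: q) x.
Proof.
apply/ffunP => j; rewrite !ffunE scalerA.
have -> : kbcoord e j (a%:A *: x : kmod M) = a * (kbcoord e j (x : kmod M) : k) :> k.
  exact: (linearZ_LR (kbcoord e j) a (x : kmod M)).
by rewrite mulr_algr scalerA.
Qed.

Lemma tpure_sum M (e : kbasis M) (w : {ffun 'I_(kbdim e) -> Q}) :
  w = \sum_j tpure e (w j) (kbvec e j).
Proof.
apply/ffunP => i; rewrite sum_ffunE (bigD1 i) //= big1 => [|j ji].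
  by rewrite ffunE kbdual eqxx scale1r scale1r addr0.
by rewrite ffunE kbdual (negPf ji) scale0r scale0r.
Qed.

(** Only k-linearity of [h] is asked, so that the actions of elements of B and k-linear splittings
    also induce maps. *)
Definition tmap M N (e : kbasis M) (f : kbasis N) (h : {linear kmod M -> kmod N})
  (w : {ffun 'I_(kbdim e) -> Q}) : {ffun 'I_(kbdim f) -> Q} :=
  \sum_j tpure f (w j) (h (kbvec e j)).

Lemma tmap_linear M N (e : kbasis M) (f : kbasis N) h : linear (@tmap M N e f h).
Proof.
move=> a u v; rewrite /tmap scaler_sumr -big_split; apply: eq_bigr => j _ /=.
by rewrite !ffunE tpure_linear.
Qed.

Lemma tpure0r M (e : kbasis M) q : tpure e q 0 = 0.
Proof. by apply: (addrI (tpure e q 0)); rewrite -tpureDr !addr0. Qed.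

Lemma tmap_pure M N (e : kbasis M) (f : kbasis N) (h : {linear kmod M -> kmod N}) q x :
  @tmap M N e f h (tpure e q x) = tpure f q (h x).
Proof.
rewrite [in RHS](kbsum e x) /tmap.
have -> : h (\sum_i (kbcoord e i x : k)%:A *: kbvec e i) =
    \sum_i (kbcoord e i x : k)%:A *: (h (kbvec e i) : N).
  rewrite -[LHS]/(h (\sum_i (kbcoord e i x : k) *: (kbvec e i : kmod M))) linear_sum.
  by apply: eq_bigr => i _; rewrite linearZ.
rewrite (big_morph _ (tpureDr f q) (tpure0r f q)).
by apply: eq_bigr => i _; rewrite ffunE tpureZ.
Qed.

Lemma tens_ext (V : zmodType) M (e : kbasis M)
    (f g : {additive {ffun 'I_(kbdim e) -> Q} -> V}) :
  (forall q x, f (tpure e q x) = g (tpure e q x)) -> f =1 g.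
Proof.
by move=> fg w; rewrite (tpure_sum w) !raddf_sum; apply: eq_bigr => j _; exact: fg.
Qed.

Lemma kscale_linear M (y : B) :
  linear ((fun x : M => y *: x) : kmod M -> kmod M).
Proof.
by move=> a u v; rewrite !kmodE scalerDr !scalerA mulr_algl mulr_algr.
Qed.

Definition kscale M y : {linear kmod M -> kmod M} := mklin (@kscale_linear M y).

Definition tens_act M (e : kbasis M) (y : B) := mklin (@tmap_linear M M e e (kscale M y)).

Lemma tens_act_pure M (e : kbasis M) y q x :
  tens_act e y (tpure e q x) = tpure e q (y *: x).
Proof. exact: tmap_pure. Qed.

Lemma tens_actD M (e : kbasis M) x y w :
  tens_act e (x + y) w = tens_act e x w + tens_act e y w.
Proof.
rewrite -[RHS]/((tens_act e x \+ tens_act e y) w).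
by apply: tens_ext => q z; rewrite /= !tmap_pure /= scalerDl tpureDr.
Qed.

Lemma tens_actM M (e : kbasis M) x y w :
  tens_act e (x * y) w = tens_act e x (tens_act e y w).
Proof.
rewrite -[RHS]/((tens_act e x \o tens_act e y) w).
by apply: tens_ext => q z; rewrite /= !tmap_pure /= scalerA.
Qed.

Lemma alg_scale_linear (W : lmodType A) (x : k) : linear (fun w : W => x%:A *: w).
Proof.
by move=> a u v; rewrite scalerDr !scalerA mulr_algl mulr_algr.
Qed.

Lemma tens_act_scalar M (e : kbasis M) (x : k) w :
  tens_act e x%:A w = x%:A *: w.
Proof.
rewrite -[RHS]/(mklin (@alg_scale_linear _ x) w).
apply: tens_ext => q z; rewrite /= tmap_pure /= tpureZ.
by apply/ffunP => i; rewrite !ffunE !scalerA mulr_algl mulr_algr.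
Qed.

Definition tens_bimodule M (e : kbasis M) :=
  Bimodule (@tens_actD M e) (@tens_actM M e) (@tens_act_scalar M e).

Definition tensm M (e : kbasis M) : lmodType T := tmod (tens_bimodule e).

End TensorModule.
End TensorCoordinates.

(** * Restriction, coinduction and reduction modulo the radical *)

Definition restrict_lin (R S : nzRingType) (f : {rmorphism R -> S})
    (X Y : lmodType S) (g : {linear X -> Y}) :
  {linear restrict_scalars f X -> restrict_scalars f Y}.
Proof.
by refine (@mklin R (restrict_scalars f X) (restrict_scalars f Y) g _) => a u v;
  rewrite !restrict_scaleE linearP.
Defined.

Lemma restrict_ses (R S : nzRingType) (f : {rmorphism R -> S})
    (X Y Z : lmodType S) (i : {linear X -> Y}) (p : {linear Y -> Z}) :
  ses i p -> ses (restrict_lin f i) (restrict_lin f p).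
Proof. by []. Qed.

(** * Lifting, extensions and retracts for Ext^1 *)

Section ExtLemmas.
Variable R : nzRingType.
Implicit Types K M N P U V W X : lmodType R.

(** Lift over a projective cover of X. On the kernel of the cover the lift takes values in K, and
    extending that restriction to the cover gives the correction. *)
Lemma ext1v_lift X K V W (j : {linear K -> V}) (q : {linear V -> W}) :
  ses j q -> ext1v X K -> forall f : {linear X -> W},
  exists g : {linear X -> V}, forall x, q (g x) = f x.
Proof.
move=> jq ext f; have [j_inj jq0 q_surj] := jq.
have [P [p [Pp p_surj _]]] := free_cover X.
have [N [i ip]] := ses_kernel p_surj.
have [t qt] := Pp _ _ q (f \o p) q_surj.
have [a ja] : exists a : {linear N -> K}, forall x, j (a x) = t (i x).
  apply: (factor_inj (f := t \o i) j_inj) => x; apply/jq0.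
  by rewrite /= qt /= (ses_comp _ ip) linear0.
have [e ei] := ext _ _ _ _ ip a.
have [i_inj ip0 _] := ip.
have [|g gp] := factor_surj (f := t \- (j \o e)) p_surj.
  by move=> x /ip0[y <-] /=; rewrite ei ja subrr.
exists g => x; have [y <-] := p_surj x.
by rewrite gp linearB qt (ses_comp _ jq) subr0.
Qed.

Lemma ext1v_extension X K V W (j : {linear K -> V}) (q : {linear V -> W}) :
  ses j q -> ext1v X K -> ext1v X W -> ext1v X V.
Proof.
move=> jq extK extW; have [j_inj jq0 q_surj] := jq.
have [P [p [Pp p_surj _]]] := free_cover X.
have [N [i ip]] := ses_kernel p_surj.
apply: (ext1v_of_one ip Pp) => f.
have [g gi] := extW _ _ _ _ ip (q \o f).
have [h qh] := Pp _ _ q g q_surj.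
have [a ja] : exists a : {linear N -> K}, forall x, j (a x) = f x - h (i x).
  apply: (factor_inj (f := f \- (h \o i)) j_inj) => x; apply/jq0.
  by rewrite linearB /= qh gi subrr.
have [e ei] := extK _ _ _ _ ip a.
by exists (h \+ (j \o e)) => x /=; rewrite ei ja addrC subrK.
Qed.

(** The two families present V as a direct summand of W^n without forming the power. *)
Lemma ext1v_retract_coeff X V W n (s : 'I_n -> {linear V -> W})
    (r : 'I_n -> {linear W -> V}) :
  (forall x, \sum_i r i (s i x) = x) -> ext1v X W -> ext1v X V.
Proof.
move=> rs ext N P i p ip f.
have /choice[g gE] : forall l, exists g : {linear P -> W},
    forall x, g (i x) = s l (f x).
  by move=> l; exact: ext _ _ _ _ ip (s l \o f).
exists (lin_sum (fun l => r l \o g l)) => x /=.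
by rewrite -[RHS]rs; apply: eq_bigr => l _; rewrite gE.
Qed.

Lemma projective_retract_sum V W n (s : 'I_n -> {linear V -> W})
    (r : 'I_n -> {linear W -> V}) :
  (forall x, \sum_i r i (s i x) = x) -> projective W -> projective V.
Proof.
move=> rs Wp M N g f g_surj.
have /choice[h gh] : forall l, exists h : {linear W -> M},
    forall x, g (h x) = f (r l x).
  by move=> l; exact: Wp _ _ g (f \o r l) g_surj.
exists (lin_sum (fun l => h l \o s l)) => x /=.
by rewrite linear_sum -[in RHS](rs x) linear_sum; apply: eq_bigr => l _; exact: gh.
Qed.

Lemma ses_section N P M (i : {linear N -> P}) (p : {linear P -> M})
    (r : {linear P -> N}) : ses i p -> (forall x, r (i x) = x) ->
  exists s : {linear M -> P}, forall x, p (s x) = x.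
Proof.
move=> ip ri; have [_ ip0 p_surj] := ip.
have [|s sp] := factor_surj (f := idfun \- (i \o r)) p_surj.
  by move=> x /ip0[y <-] /=; rewrite ri subrr.
exists s => x; have [y <-] := p_surj x.
by rewrite sp linearB (ses_comp _ ip) subr0.
Qed.

Lemma nilpotent_left_inverse n X (psi : {linear X -> X}) :
  (forall x, iter n psi x = 0) ->
  exists chi : {linear X -> X}, forall x, chi (x - psi x) = x.
Proof.
move=> psin.
have li m : linear (iter m psi).
  by elim: m => // m IHm a u v; rewrite iterS IHm linearP.
exists (lin_sum (fun i : 'I_n => mklin (li i))) => x.
rewrite linearB /= -sumrB -[RHS]subr0 -[X in _ = _ - X](psin x).
elim: (n) => [|m IHm]; first by rewrite big_ord0 subrr.
by rewrite big_ord_recr /= IHm -iterSr addrA subrK.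
Qed.

End ExtLemmas.

Section TensorTheory.
Variables (k : fieldType) (A : algType k) (B : falgType k).
Variables (T : tensor_product A B) (rB : kbasis (B^o : lmodType B)).
Implicit Types (Q : lmodType A) (M N : lmodType B) (X Y Z V : lmodType T).

Notation resA X := (restrict_scalars (tensl T) X).
Notation resB X := (restrict_scalars (tensr T) X).
Notation "Q ⊗ e" := (tensm T rB Q e) (at level 40).

Lemma tens_tensl Q M (e : kbasis M) a (w : Q ⊗ e) :
  tensl T a *: w = a *: (w : {ffun 'I_(kbdim e) -> Q}) :> {ffun 'I_(kbdim e) -> Q}.
Proof. exact: tmod_tensl. Qed.

Lemma tens_tensr Q M (e : kbasis M) b (w : Q ⊗ e) :
  tensr T b *: w = tens_act Q e b w :> {ffun 'I_(kbdim e) -> Q}.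
Proof. exact: tmod_tensr. Qed.

Definition tp Q M (e : kbasis M) (q : Q) (x : M) : Q ⊗ e := tpure e q x.

Lemma tpDl Q M (e : kbasis M) (p q : Q) x : tp e (p + q) x = tp e p x + tp e q x.
Proof. by apply/ffunP => i; rewrite !ffunE scalerDr. Qed.

Lemma tpDr Q M (e : kbasis M) (q : Q) x y : tp e q (x + y) = tp e q x + tp e q y.
Proof. exact: tpureDr. Qed.

Lemma tens_scalar (a : k) : tensr T a%:A = tensl T a%:A.
Proof. by rewrite !linearZ /= !rmorph1. Qed.

Lemma tp_tensr Q M (e : kbasis M) b (q : Q) x :
  tensr T b *: tp e q x = tp e q (b *: x).
Proof. by rewrite [LHS]tens_tensr; exact: tens_act_pure. Qed.

Lemma tp_tensl Q M (e : kbasis M) a (q : Q) x :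
  tensl T a *: tp e q x = tp e (a *: q) x.
Proof.
rewrite [LHS]tens_tensl; apply/ffunP => i.
by rewrite !ffunE !scalerA mulr_algl mulr_algr.
Qed.

Lemma tp_eq Q M (e : kbasis M) (V : zmodType) (f g : Q ⊗ e -> V) :
  (forall u v, f (u + v) = f u + f v) -> (forall u v, g (u + v) = g u + g v) ->
  (forall q x, f (tp e q x) = g (tp e q x)) -> f =1 g.
Proof.
move=> fD gD fg w.
have f0 : f 0 = 0 by apply: (addrI (f 0)); rewrite -fD !addr0.
have g0 : g 0 = 0 by apply: (addrI (g 0)); rewrite -gD !addr0.
have -> : w = \sum_j tp e ((w : {ffun _ -> _}) j) (kbvec e j) by exact: tpure_sum.
rewrite (big_morph f fD f0) (big_morph g gD g0).
by apply: eq_bigr => j _.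
Qed.

(** Additive balanced maps are the common ground for lifts linear over A (x) B and for lifts linear
    over B alone, as in [tens_regular_resB]. *)
Lemma tens_lift_add Q M (e : kbasis M) (V : zmodType) (phi : Q -> M -> V) :
  (forall p q x, phi (p + q) x = phi p x + phi q x) ->
  (forall q x y, phi q (x + y) = phi q x + phi q y) ->
  (forall c q x, phi (c%:A *: q) x = phi q (c%:A *: x)) ->
  exists f : Q ⊗ e -> V, (forall u v, f (u + v) = f u + f v) /\
    forall q x, f (tp e q x) = phi q x.
Proof.
move=> phiDl phiDr phiZ.
exists (fun w : {ffun 'I_(kbdim e) -> Q} => \sum_j phi (w j) (kbvec e j)); split.
  by move=> u v; rewrite -big_split; apply: eq_bigr => j _; rewrite ffunE phiDl.
move=> q x; have phi0 : phi q 0 = 0.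
  by apply: (addrI (phi q 0)); rewrite -phiDr !addr0.
rewrite [in RHS](kbsum e x) (big_morph _ (phiDr q) phi0).
by apply: eq_bigr => j _; rewrite ffunE phiZ.
Qed.

Lemma tens_lift_linear Q M (e : kbasis M) V (phi : Q -> M -> V) :
  (forall a p q x, phi (a *: p + q) x = tensl T a *: phi p x + phi q x) ->
  (forall q x y, phi q (x + y) = phi q x + phi q y) ->
  (forall b q x, phi q (b *: x) = tensr T b *: phi q x) ->
  exists f : {linear Q ⊗ e -> V}, forall q x, f (tp e q x) = phi q x.
Proof.
move=> phil phiDr phir.
have phiDl p q x : phi (p + q) x = phi p x + phi q x.
  by have := phil 1 p q x; rewrite rmorph1 !scale1r.
have phiA a q x : phi (a *: q) x = tensl T a *: phi q x.
  have := phil a q 0 x; rewrite addr0 => ->.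
  by rewrite (_ : phi 0 x = 0) ?addr0 //; apply: (addrI (phi 0 x)); rewrite -phiDl !addr0.
have [|f [fD fE]] := @tens_lift_add Q M e _ phi phiDl phiDr.
  by move=> c q x; rewrite phiA phir !linearZ /= !rmorph1.
have lf : linear f.
  apply: tens_linear => // [a|b]; apply: tp_eq => [u v|u v|q x].
  - by rewrite scalerDr fD.
  - by rewrite fD scalerDr.
  - by rewrite tp_tensl !fE phiA.
  - by rewrite scalerDr fD.
  - by rewrite fD scalerDr.
  - by rewrite tp_tensr !fE phir.
by exists (mklin lf).
Qed.

Lemma tens_map_exists Q M N (e : kbasis M) (f : kbasis N) (h : {linear M -> N}) :
  exists g : {linear Q ⊗ e -> Q ⊗ f}, forall w, g w = tmap f (klinear h) w.
Proof.
have tD (u v : Q ⊗ e) : tmap f (klinear h) (u + v : Q ⊗ e) =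
    (tmap f (klinear h) u : Q ⊗ f) + tmap f (klinear h) v.
  exact: (linearD (mklin (@tmap_linear _ _ _ Q _ _ e f (klinear h)))).
have [|||g gE] := @tens_lift_linear Q M e (Q ⊗ f) (fun q x => tp f q (h x)).
- by move=> a p q x; rewrite tp_tensl tpDl.
- by move=> q x y; rewrite linearD tpDr.
- by move=> b q x; rewrite linearZ tp_tensr.
exists g => w; apply: (tp_eq (f := g) (g := tmap f (klinear h))) => [u v|//|q x].
  by rewrite linearD.
by rewrite gE; apply: esym; exact: tmap_pure.
Qed.

Definition tens_map Q M N (e : kbasis M) (f : kbasis N) (h : {linear M -> N}) :
  {linear Q ⊗ e -> Q ⊗ f} := projT1 (cid (tens_map_exists Q e f h)).

Lemma tens_mapE Q M N (e : kbasis M) (f : kbasis N) (h : {linear M -> N}) w :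
  tens_map Q e f h w = tmap f (klinear h) w.
Proof. exact: (projT2 (cid (tens_map_exists Q e f h))). Qed.

Lemma tens_map_tp Q M N (e : kbasis M) (f : kbasis N) (h : {linear M -> N}) q x :
  tens_map Q e f h (tp e q x) = tp f q (h x).
Proof. by rewrite tens_mapE; exact: tmap_pure. Qed.

Lemma tens_map_sum Q M N n (e : kbasis M) (f : kbasis N) (s : 'I_n -> {linear M -> N})
    (r : 'I_n -> {linear N -> M}) : (forall x, \sum_i r i (s i x) = x) ->
  forall w, \sum_i tens_map Q f e (r i) (tens_map Q e f (s i) w) = w.
Proof.
move=> rs; apply: tp_eq => [u v|//|q x].
  by rewrite -big_split; apply: eq_bigr => i _; rewrite !linearD.
under eq_bigr do rewrite !tens_map_tp.
by rewrite -{2}(rs x) (big_morph _ (tpDr e q) (tpure0r e q)).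
Qed.

(** The sequence of B-modules splits over k, and the splitting induces additive maps on the tensor
    products. Exactness concerns underlying groups only, so these suffice. *)
Lemma tens_map_ses Q K M N (eK : kbasis K) (eM : kbasis M) (eN : kbasis N)
    (i : {linear K -> M}) (p : {linear M -> N}) : ses i p ->
  ses (tens_map Q eK eM i) (tens_map Q eM eN p).
Proof.
move=> ip; have [i_inj _ p_surj] := ip.
have [s ps] : exists s : {linear kmod N -> kmod M}, forall x, p (s x) = x.
  exact: (semisimple_section (@field_semisimple _ (kmod M)) (p := klinear p) p_surj).
have ipk : ses (klinear i) (klinear p) by [].
have [r ir] := ses_retraction ipk ps.
have ri := ses_retractionK ipk ir.
pose tr := mklin (@tmap_linear _ _ _ Q _ _ eM eK r).
pose ts := mklin (@tmap_linear _ _ _ Q _ _ eN eM s).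
have trE q x : tr (tp eM q x) = tp eK q (r x) by exact: tmap_pure.
have tsE q x : ts (tp eN q x) = tp eM q (s x) by exact: tmap_pure.
have trD (u v : Q ⊗ eM) : tr (u + v : Q ⊗ eM) = tr u + tr v by exact: (linearD tr).
have tsD (u v : Q ⊗ eN) : ts (u + v : Q ⊗ eN) = ts u + ts v by exact: (linearD ts).
have triE (w : Q ⊗ eK) : tr (tens_map Q eK eM i w) = w.
  move: w; apply: tp_eq => [u v|//|q x]; first by rewrite linearD trD.
  by rewrite tens_map_tp trE; congr (tp eK q _); exact: ri.
have ptsE (w : Q ⊗ eN) : tens_map Q eM eN p (ts w) = w.
  move: w; apply: tp_eq => [u v|//|q x]; first by rewrite tsD; exact: linearD.
  by rewrite tsE tens_map_tp ps.
have sumE (w : Q ⊗ eM) :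
    tens_map Q eK eM i (tr w) + (ts (tens_map Q eM eN p w) : Q ⊗ eM) = w.
  move: w; apply: tp_eq => [u v|//|q x].
    rewrite trD [tens_map Q eM eN p _]linearD tsD [tens_map Q eK eM i _]linearD.
    exact: addrACA.
  rewrite trE !tens_map_tp tsE; apply: etrans (esym (tpureDr _ _ _ _)) _.
  by congr (tpure _ _ _); rewrite -[i _]/(klinear i _) ir; exact: subrK.
split; first exact: can_inj triE.
- move=> w; split=> [pw|[v <-]].
    exists (tr w); rewrite -[RHS]sumE pw.
    by rewrite [ts 0](linear0 ts); apply: esym; exact: addr0.
  move: v; apply: (tp_eq (g := fun=> 0)) => [u v|u v|q x].
  + by rewrite !linearD.
  + by rewrite addr0.
  + by rewrite !tens_map_tp (ses_comp _ ip); exact: tpure0r.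
- by move=> w; exists (ts w).
Qed.

(** Q (x) B is induced from A: a map out of it is determined by an arbitrary A-linear map on the
    elements q (x) 1. *)
Lemma tens_regular_projective Q : projective Q -> projective (Q ⊗ rB).
Proof.
move=> Qp U V g f g_surj.
have lf : linear ((fun q => f (tp rB q (1 : B^o))) : Q -> resA V).
  by move=> a p q; rewrite restrict_scaleE -linearZ tp_tensl -linearD tpDl.
have [h gh] := Qp _ _ (restrict_lin (tensl T) g) (mklin lf) g_surj.
have [|||t tE] := @tens_lift_linear Q B^o rB U (fun q x => tensr T (x : B) *: (h q : U)).
- move=> a p q x; rewrite linearP restrict_scaleE scalerDr !scalerA.
  by rewrite tens_comm.
- by move=> q x y; rewrite linearD scalerDl.
- by move=> b q x; rewrite rmorphM scalerA.
exists t; apply: (tp_eq (f := g \o t) (g := f)) => [u v|u v|q x] /=.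
- by rewrite !linearD.
- by rewrite linearD.
rewrite tE linearZ /= -[g (h q)]/(restrict_lin (tensl T) g (h q)) gh /=.
by rewrite -linearZ tp_tensr -[X in tp rB q X]/(x * 1 : B) mulr1.
Qed.

Lemma fd_projective_dual_basis M (e : kbasis M) : projective M ->
  exists f : 'I_(kbdim e) -> {linear M -> B^o},
    forall x, \sum_l lin_scale (kbvec e l) (f l x) = x.
Proof.
move=> Mp.
have lp : linear (fun w : {ffun 'I_(kbdim e) -> B^o} => \sum_l (w l : B) *: kbvec e l).
  move=> a u v; rewrite scaler_sumr -big_split; apply: eq_bigr => l _ /=.
  by rewrite !ffunE scalerDl scalerA.
have [|s ps] := projective_section (p := mklin lp) _ Mp.
  move=> x; exists [ffun l => (kbcoord e l (x : kmod M) : k)%:A] => /=.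
  by rewrite [RHS](kbsum e x); apply: eq_bigr => l _; rewrite ffunE.
have lc l : linear (fun x => s x l : B^o).
  by move=> a u v; rewrite linearP !ffunE.
by exists (fun l => mklin (lc l)) => x; exact: ps.
Qed.

Lemma tens_projective Q M (e : kbasis M) :
  projective Q -> projective M -> projective (Q ⊗ e).
Proof.
move=> Qp Mp; have [f fE] := fd_projective_dual_basis e Mp.
have fE' := @tens_map_sum Q M B^o _ e rB f (fun l => lin_scale (kbvec e l)) fE.
exact: projective_retract_sum fE' (tens_regular_projective Qp).
Qed.

Lemma tens_cover X : exists Q (p : {linear Q ⊗ rB -> X}), projective Q /\ surjective p.
Proof.
have [Q [q [Qp q_surj _]]] := free_cover (resA X).
have [|||t tE] := @tens_lift_linear Q B^o rB X (fun a x => tensr T (x : B) *: (q a : X)).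
- move=> a u v x; rewrite linearP restrict_scaleE scalerDr !scalerA.
  by rewrite tens_comm.
- by move=> a x y; rewrite linearD scalerDl.
- by move=> b a x; rewrite rmorphM scalerA.
exists Q, t; split=> // x; have [a qa] := q_surj x.
by exists (tp rB a 1); rewrite tE rmorph1 scale1r.
Qed.

(** Over B, the module Q (x) B is induced from the k-space Q, and every k-space is projective. *)
Lemma tens_regular_resB Q : projective (resB (Q ⊗ rB)).
Proof.
move=> U V g f g_surj.
have lf : linear ((fun q => f (tp rB q (1 : B^o))) :
    restrict_scalars (in_alg A) Q -> kmod V).
  move=> a p q; rewrite restrict_scaleE tpDl.
  have -> : tp rB (a%:A *: (p : Q)) (1 : B^o) = a%:A *: (tp rB p (1 : B^o) : resB (Q ⊗ rB)).
    by rewrite restrict_scaleE tp_tensr; apply: esym; exact: tpureZ.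
  by rewrite linearP.
have [h gh] := @field_projective k _ _ _ (klinear g) (mklin lf) g_surj.
have [|||t [tD tE]] := @tens_lift_add Q B^o rB U (fun q x => (x : B) *: (h q : U)).
- by move=> p q x; rewrite linearD scalerDr.
- by move=> q x y; rewrite scalerDl.
- move=> a q x.
  rewrite -[h _]/(h (a *: (q : restrict_scalars (in_alg A) Q))) linearZ /= kmodE.
  by rewrite scalerA -[a%:A *: x]/(a%:A * x : B) mulr_algl mulr_algr.
have lt : linear (t : resB (Q ⊗ rB) -> U).
  move=> y u v; rewrite restrict_scaleE tD; congr (_ + _).
  move: u; apply: (tp_eq (f := fun u => t (tensr T y *: u))) => [u w|u w|q x].
  - by rewrite scalerDr tD.
  - by rewrite tD scalerDr.
  - by rewrite tp_tensr !tE scalerA.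
exists (mklin lt); apply: (tp_eq (f := fun w => g (t w)) (g := f)) => [u w|u w|q x] /=.
- by rewrite tD linearD.
- exact: linearD.
rewrite tE linearZ /= -[g (h q)]/(klinear g (h q)) gh /=.
rewrite -linearZ restrict_scaleE tp_tensr -[X in tp rB q X]/(x * 1 : B).
by rewrite mulr1.
Qed.

Lemma projective_resB X : projective X -> projective (resB X).
Proof.
move=> Xp; have [Q [p [_ p_surj]]] := tens_cover X.
have [s ps] := projective_section p_surj Xp.
apply: (projective_retract (s := restrict_lin (tensr T) s)
  (r := restrict_lin (tensr T) p)) (@tens_regular_resB Q).
exact: ps.
Qed.

(** * The coinduction adjunction and reduction modulo J *)

Variable rc : radical_coordinates B.
Notation J := (rad B^o).
Notation eD := (dual_kbasis rc).
Notation b := (rcvec rc).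
Notation c := (rccoord rc).

Definition rad_kills X Q (f : X -> Q) : Prop :=
  forall y x, y \in J -> f (tensr T y *: x) = 0.

Lemma rad_kills_expand X Q (f : {linear resA X -> Q}) (y : B) (x : X) :
  rad_kills f -> f (tensr T y *: x) =
    \sum_i (c i (y : B^o) : k)%:A *: f (tensr T (b i) *: x).
Proof.
move=> fJ; have := fJ _ x (rcsum rc y).
rewrite rmorphB scalerBl -[LHS]/(f ((_ : resA X) - _)) linearB.
move/eqP; rewrite subr_eq0 => /eqP->; rewrite rmorph_sum scaler_suml.
rewrite -[LHS]/(f (\sum_i (_ : resA X))) linear_sum; apply: eq_bigr => i _.
rewrite -linearZ restrict_scaleE; congr (f _).
by rewrite rmorphM -scalerA; apply: (congr1 (fun t : T => t *: _)); exact: tens_scalar.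
Qed.

Lemma dual_tens_tensr Q (w : Q ⊗ eD) y i :
  (tensr T y *: w : {ffun 'I_(rcdim rc) -> Q}) i =
    \sum_j (c j (b i * y : B^o) : k)%:A *: (w : {ffun 'I_(rcdim rc) -> Q}) j.
Proof.
rewrite [tensr T y *: w]tens_tensr /= /tmap sum_ffunE; apply: eq_bigr => j _.
rewrite ffunE /=; congr (_%:A *: _).
rewrite [LHS]ffunE (bigD1 j) //= ffunE eqxx mulr1 big1 ?addr0 // => l lj.
by rewrite ffunE eq_sym (negPf lj) mulr0.
Qed.

(* Hom_A (B / J tensor_B X, Q) = Hom_T (X, Hom_k (B / J, Q)) *)
Lemma coinduce X Q (f : {linear resA X -> Q}) : rad_kills f ->
  exists h : {linear X -> Q ⊗ eD}, forall x i,
    (h x : {ffun 'I_(rcdim rc) -> Q}) i = f (tensr T (b i) *: x).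
Proof.
move=> fJ.
pose h (x : X) : {ffun 'I_(rcdim rc) -> Q} := [ffun i => f (tensr T (b i) *: x)].
have lh : linear (h : X -> Q ⊗ eD).
  apply: (tens_linear rB) => [x y|a x|y x].
  - by apply/ffunP => i; rewrite !ffunE scalerDr; exact: (linearD f).
  - rewrite tens_tensl; apply/ffunP => i; rewrite !ffunE -linearZ.
    by rewrite restrict_scaleE !scalerA tens_comm.
  - apply/ffunP => i; rewrite ffunE dual_tens_tensr scalerA -rmorphM.
    rewrite (rad_kills_expand _ _ fJ).
    by apply: eq_bigr => j _; rewrite ffunE.
by exists (mklin lh) => x i; rewrite /= ffunE.
Qed.

Lemma coinduce_inv X Q (h : {linear X -> Q ⊗ eD}) :
  exists f : {linear resA X -> Q}, rad_kills f /\ forall x i,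
    f (tensr T (b i) *: x) = (h x : {ffun 'I_(rcdim rc) -> Q}) i.
Proof.
(* This evaluates the functional [h x] at 1, with 1 expanded modulo J in the [b i]. *)
pose f (x : X) : Q :=
  \sum_j (c j (1 : B^o) : k)%:A *: (h x : {ffun 'I_(rcdim rc) -> Q}) j.
have lf : linear (f : resA X -> Q).
  move=> a x y; rewrite /f scaler_sumr -big_split; apply: eq_bigr => j _ /=.
  rewrite restrict_scaleE linearD linearZ /= ffunE tens_tensl ffunE scalerDr.
  by rewrite !scalerA mulr_algl mulr_algr.
have fE y x : f (tensr T y *: x) =
    \sum_l (c l (y : B^o) : k)%:A *: (h x : {ffun 'I_(rcdim rc) -> Q}) l.
  rewrite /f linearZ /=.
  under eq_bigr do rewrite dual_tens_tensr scaler_sumr.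
  rewrite exchange_big; apply: eq_bigr => l _ /=.
  rewrite -[y in RHS]mul1r rcM !scaler_suml; apply: eq_bigr => j _.
  by rewrite scalerA -scalerAl mul1r scalerA.
exists (mklin lf); split=> [y x Jy|x i] /=.
  by rewrite fE big1 // => l _; rewrite rccoord_rad // !scale0r.
rewrite fE (bigD1 i) //= big1 => [|j ji].
  by rewrite rcdual eqxx !scale1r addr0.
by rewrite rcdual eq_sym (negPf ji) !scale0r.
Qed.

(** The [b i] span B modulo J, so the value at 1 is a combination of the values at the [b i]. *)
Lemma rad_kills_eq X Y Q (f : {linear resA X -> Q}) (g : {linear resA Y -> Q}) x y :
  rad_kills f -> rad_kills g ->
  (forall i, f (tensr T (b i) *: (x : X)) = g (tensr T (b i) *: (y : Y))) ->
  f x = g y.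
Proof.
move=> fJ gJ fg.
rewrite -[x](scale1r (x : X)) -[y](scale1r (y : Y)) -(rmorph1 (tensr T)).
rewrite (rad_kills_expand _ _ fJ) (rad_kills_expand _ _ gJ).
by apply: eq_bigr => i _; rewrite fg.
Qed.

Notation bar X := (modquot (radB X)).
Notation barA X := (restrict_scalars (tensl T) (modquot (radB X))).

Definition barp X : {linear X -> bar X} := modproj (radB X).

Lemma barp_surj X : surjective (barp X).
Proof. exact: modproj_surj. Qed.

Lemma barp0 X (x : X) : barp X x = 0 <-> x \in rad (resB X).
Proof.
have := modproj_eq (radB X) x 0; rewrite subr0 -[modproj _ 0]/(barp X 0) linear0.
exact.
Qed.

Lemma bar_map X Y (f : {linear X -> Y}) :
  exists g : {linear bar X -> bar Y}, forall x, g (barp X x) = barp Y (f x).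
Proof.
apply: (factor_surj (f := barp Y \o f) (barp_surj (X := X))) => x /barp0 rx.
by apply/barp0; exact: (rad_linear (restrict_lin (tensr T) f) rx).
Qed.

Lemma rad_kills_bar X Q (g : {linear barA X -> Q}) :
  rad_kills (g \o restrict_lin (tensl T) (barp X)).
Proof.
move=> y x Jy /=; rewrite (_ : barp X _ = 0) ?linear0 //; apply/barp0.
exact: (@rad_scale _ (resB X) y x Jy).
Qed.

(** The kernel of [barp] is an intersection of maximal submodules, while [f] is known to vanish on J
    X. Projectivity over B bridges the two through [rad_projective]. *)
Lemma bar_factor X Q (f : {linear resA X -> Q}) : projective (resB X) ->
  rad_kills f -> exists g : {linear barA X -> Q}, forall x, g (barp X x) = f x.
Proof.
move=> Xp fJ.
apply: (@factor_surj _ (resA X) (barA X) Q (restrict_lin (tensl T) (barp X)) f).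
  exact: barp_surj.
move=> x /barp0/(rad_projective Xp)[n [j [y [Jj xE]]]].
rewrite [LHS](_ : _ = f (\sum_i (tensr T (j i) *: (y i : X) : resA X))).
  by rewrite linear_sum big1 // => i _; exact: fJ.
by rewrite xE.
Qed.

(** The sequence splits over B, and B-linear maps respect radicals. The splitting need not be
    A-linear, but exactness of the reduced sequence is checked on elements. *)
Lemma bar_ses X Y Z (i : {linear X -> Y}) (p : {linear Y -> Z}) :
  ses i p -> projective (resB Z) -> exists (i' : {linear bar X -> bar Y})
    (p' : {linear bar Y -> bar Z}),
  [/\ ses i' p', forall x, i' (barp X x) = barp Y (i x)
    & forall x, p' (barp Y x) = barp Z (p x)].
Proof.
move=> ip Zp; have [i' i'E] := bar_map i; have [p' p'E] := bar_map p.
exists i', p'; split=> //.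
have ipB : ses (restrict_lin (tensr T) i) (restrict_lin (tensr T) p) := ip.
have [_ _ p_surj] := ipB; have [s ps] := projective_section p_surj Zp.
have [r ir] := ses_retraction ipB ps; have ri := ses_retractionK ipB ir.
split.
- have i'_inj u : i' u = 0 -> u = 0.
    have [x <-] := barp_surj u; rewrite i'E => /barp0/(rad_linear r).
    by rewrite [r _]ri => /barp0.
  exact: raddf_inj i'_inj.
- move=> u; have [y <-] := barp_surj u; split=> [|[v <-]]; last first.
    by have [x <-] := barp_surj v; rewrite i'E p'E (ses_comp _ ip) linear0.
  rewrite p'E => /barp0/(rad_linear s) rs.
  exists (barp X (r y)); rewrite i'E -[i _]/(restrict_lin (tensr T) i (r y)) ir.
  rewrite [LHS]linearB (_ : barp Y (s (p y)) = 0) ?subr0 //.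
  exact/barp0.
- move=> w; have [z <-] := barp_surj w; have [y <-] := p_surj z.
  by exists (barp Y y); rewrite p'E.
Qed.

End TensorTheory.

(** * The theorem *)

(* Every term of a complete resolution is a syzygy of arbitrarily high order. *)
Lemma GPc_restrict_projective (R S : nzRingType) (f : {rmorphism R -> S}) n :
  (forall P : lmodType S, projective P -> projective (restrict_scalars f P)) ->
  (forall M : lmodType R, pd_le n M) ->
  forall X : lmodType S, GPc X -> projective (restrict_scalars f X).
Proof.
move=> Pf gl.
(* Weakening the bound to restrictions of modules in [GPc] makes it improvable: each such module is
   a syzygy of another one, which lowers n by one. *)
have {}gl : forall X : lmodType S, GPc X -> pd_le n (restrict_scalars f X).
  by move=> X _; exact: gl.
elim: n gl => [//|n IHn] gl; apply: IHn => X GX.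
have [_ [Y [P [i [p [ip Pp GY]]]]] _] := GPc_class GX.
exact: pd_le_syzygy (restrict_ses f ip) (Pf P Pp) (gl Y GY).
Qed.

Section Main.
Variables (k : fieldType) (A : algType k) (B : falgType k).
Variables (T : tensor_product A B) (rB : kbasis (B^o : lmodType B)).
Variable rc : radical_coordinates B.
Implicit Types (Q : lmodType A) (M N : lmodType B) (X Y Z V : lmodType T).

Notation resA X := (restrict_scalars (tensl T) X).
Notation resB X := (restrict_scalars (tensr T) X).
Notation "Q ⊗ e" := (tensm T rB Q e) (at level 40).
Notation J := (rad B^o).
Notation eD := (dual_kbasis rc).
Notation b := (rcvec rc).
Notation bar X := (modquot (radB X)).
Notation barA X := (restrict_scalars (tensl T) (modquot (radB X))).

(** * Transfer of projectivity and Ext^1 along the adjunction *)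

Lemma bar_coinduce X Q (f : {linear barA X -> Q}) :
  exists h : {linear X -> Q ⊗ eD}, forall x i,
    (h x : {ffun 'I_(rcdim rc) -> Q}) i = f (barp X (tensr T (b i) *: x)).
Proof. exact: (coinduce rB rc (rad_kills_bar f)). Qed.

Lemma bar_coinduce_inv X Q (h : {linear X -> Q ⊗ eD}) : projective (resB X) ->
  exists f : {linear barA X -> Q}, forall x i,
    f (barp X (tensr T (b i) *: x)) = (h x : {ffun 'I_(rcdim rc) -> Q}) i.
Proof.
move=> Xp; have [f [fJ fE]] := coinduce_inv h.
have [g gE] := bar_factor Xp fJ.
by exists g => x i; rewrite gE fE.
Qed.

Lemma bar_eq X Y Q (f : {linear barA X -> Q}) (g : {linear barA Y -> Q}) x y :
  (forall i, f (barp X (tensr T (b i) *: x)) = g (barp Y (tensr T (b i) *: y))) ->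
  f (barp X x) = g (barp Y y).
Proof. exact: (rad_kills_eq (rad_kills_bar f) (rad_kills_bar g)). Qed.

(** [tens_map] varies only the B-module. Functoriality in the A-module comes from the adjunction, as
    the adjoint of [g] composed with the counit [e]. *)
Lemma coinduced_surj (U V : lmodType A) (g : {linear U -> V}) : surjective g ->
  exists G : {linear U ⊗ eD -> V ⊗ eD}, surjective G /\ forall w i,
    (G w : {ffun 'I_(rcdim rc) -> V}) i = g ((w : {ffun 'I_(rcdim rc) -> U}) i).
Proof.
move=> g_surj; have [e [eJ eE]] := coinduce_inv (idfun : {linear U ⊗ eD -> U ⊗ eD}).
have geJ : rad_kills (g \o e) by move=> y x Jy /=; rewrite eJ ?linear0.
have [G GE] := coinduce rB rc geJ.
have GE' w i : (G w : {ffun 'I_(rcdim rc) -> V}) i = g ((w : {ffun 'I_(rcdim rc) -> U}) i).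
  by rewrite GE /= eE.
exists G; split=> // w; have /choice[u gu] := g_surj.
exists ([ffun i => u ((w : {ffun 'I_(rcdim rc) -> V}) i)] : {ffun 'I_(rcdim rc) -> U}).
by apply/ffunP => i; rewrite GE' ffunE gu.
Qed.

(** Reduction modulo J is left adjoint to Q |-> Q (x) D, which preserves surjections. *)
Lemma bar_projective X : projective X -> projective (barA X).
Proof.
move=> Xp U V g f g_surj.
have XpB : projective (resB X) := projective_resB rB Xp.
have [h hE] := bar_coinduce f; have [G [G_surj GE]] := coinduced_surj g_surj.
have [h' Gh'] := Xp _ _ G h G_surj; have [f' f'E] := bar_coinduce_inv h' XpB.
exists f' => u; have [x <-] := barp_surj u.
by apply: (bar_eq (f := g \o f') (g := f)) => i /=; rewrite f'E -GE Gh' hE.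
Qed.

(** A free cover of X stays exact modulo J because X is B-projective. The adjunction then matches
    the extension problem over A with the one over A (x) B. *)
Lemma ext1v_bar X Q : projective (resB X) -> ext1v X (Q ⊗ eD) -> ext1v (barA X) Q.
Proof.
move=> Xp ext.
have [F [p [Fp p_surj _]]] := free_cover X; have [K [i ip]] := ses_kernel p_surj.
have FpB : projective (resB F) := projective_resB rB Fp.
have [i' [p' [ip' i'E p'E]]] := bar_ses ip Xp.
apply: (ext1v_of_one (restrict_ses (tensl T) ip') (bar_projective Fp)) => f.
have [h hE] := bar_coinduce f; have [h' h'i] := ext _ _ _ _ ip h.
have [g gE] := bar_coinduce_inv h' FpB.
exists g => u; have [x <-] := barp_surj u; rewrite /= i'E.
by apply: bar_eq => j; rewrite gE h'i hE.
Qed.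

Lemma ext1v_coinduced X Q : projective (resB X) ->
  ext1v (barA X) Q -> ext1v X (Q ⊗ eD).
Proof.
move=> Xp ext.
have [F [p [Fp p_surj _]]] := free_cover X; have [K [i ip]] := ses_kernel p_surj.
have FpB : projective (resB F) := projective_resB rB Fp.
have KpB : projective (resB K) := projective_kernel (restrict_ses (tensr T) ip) FpB Xp.
have [i' [p' [ip' i'E p'E]]] := bar_ses ip Xp.
apply: (ext1v_of_one ip Fp) => h; have [f fE] := bar_coinduce_inv h KpB.
have [g gi] := ext _ _ _ _ (restrict_ses (tensl T) ip') f.
have [h' h'E] := bar_coinduce g.
exists h' => x; apply/ffunP => j; rewrite h'E -fE -gi /= i'E.
by congr (g (barp F _)); rewrite linearZ.
Qed.

(** Dimension shift on both sides: with K the kernel of F -> M and X' a syzygy of X, a map X' -> Q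
    (x) M lifts to Q (x) F because Ext^1(X', Q (x) K) = 0 by induction, and the lift extends because
    Q (x) F is projective. *)
Lemma tens_syzygies_ext1v n M (e : kbasis M) Q X :
  projective Q -> pd_le n M -> GPc X -> ext1v X (Q ⊗ e).
Proof.
move=> Qp; elim: n M e X => [|n IHn] M e X Mn GX.
  have [ext _ _] := GPc_class GX; apply: ext; exact: tens_projective.
have [F [p [Fp p_surj [m Fm]]]] := kdim_cover (kdim_kbasis e).
have [K [i ip]] := ses_kernel p_surj; have [i_inj _ _] := ip.
have [eF _] := kbasis_exists Fm.
have [eK _] := kbasis_exists (kdim_submodule i_inj Fm).
have Kn := pd_le_syzygy ip Fp Mn.
have sQ := tens_map_ses T rB Q eK eF e ip.
have [_ _ [X' [P [j [q [jq Pp GX']]]]]] := GPc_class GX.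
apply: (ext1v_of_one jq Pp) => f.
have [f' f'E] := ext1v_lift sQ (IHn K eK X' Kn GX') f.
have [ext _ _] := GPc_class GX.
have [g gE] := ext _ (tens_projective (e := eF) Qp Fp) _ _ _ _ jq f'.
by exists (tens_map T rB Q eF e p \o g) => x; rewrite /= gE f'E.
Qed.

Lemma bar_GPc X : finite_global_dimension B -> GPc X ->
  GPc (barA X) /\ projective (resB X).
Proof.
move=> [n gl] GX; have {}gl M : pd_le n M by exact/projdim_pd_le/gl.
have GXp Y : GPc Y -> projective (resB Y).
  by apply: (GPc_restrict_projective (n := n)) => // P; exact: projective_resB.
split; last exact: GXp.
exists (fun L : lmodType A => exists2 Y, GPc Y & L = barA Y); last by exists X.
move=> {X GX} _ [X GX ->].
have [_ [Y [P [i [p [ip Pp GY]]]]] [Z [P' [i' [p' [ip' Pp' GZ]]]]]] := GPc_class GX.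
split.
- move=> Q Qp; apply: ext1v_bar; first exact: GXp.
  exact: (tens_syzygies_ext1v Qp (gl _) GX).
- have [j [q [jq _ _]]] := bar_ses ip (GXp Y GY).
  exists (barA Y), (barA P), (restrict_lin (tensl T) j), (restrict_lin (tensl T) q).
  by split; [exact: jq | exact: bar_projective | exists Y].
- have [j [q [jq _ _]]] := bar_ses ip' (GXp X GX).
  exists (barA Z), (barA P'), (restrict_lin (tensl T) j), (restrict_lin (tensl T) q).
  by split; [exact: jq | exact: bar_projective | exists Z].
Qed.

(** * Ascent from X/JX to X *)

Lemma ext1v_tens n M (e : kbasis M) Q X : projective (resB X) ->
  ext1v (barA X) Q -> kdim_le n M -> ext1v X (Q ⊗ e).
Proof.
move=> Xp ext; elim/ltn_ind: n M e => n IHn M e Mn.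
have [M0|/existsNP[x x0]] := pselect (forall x : M, x = 0).
  move=> N P i p ip f; exists \0 => y /=; move: (f y).
  apply: (tp_eq (f := fun=> 0) (g := id)) => [u v|//|q x]; first by rewrite addr0.
  by rewrite [x]M0; apply: esym; exact: tpure0r.
have [N [i [i_inj iE]]] := rad_submodule M.
have [m ltmn Nm] := kdim_rad i_inj iE Mn x0.
have [L [p ip]] := ses_cokernel i_inj; have [_ ip0 p_surj] := ip.
have JL : rad_killed L.
  by apply: rad_killed_quotient p_surj _ => y /iE ry; exact/ip0.
have [eN _] := kbasis_exists Nm.
have [eL _] := kbasis_exists (kdim_quotient p_surj Mn).
apply: ext1v_extension (tens_map_ses T rB Q eN e eL ip) (IHn m ltmn N eN Nm) _.
have [f [g fg]] := dual_top_cogenerates rc eL JL.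
have fg' := @tens_map_sum _ _ _ T rB Q L _ _ eL eD f g fg.
exact: ext1v_retract_coeff fg' (ext1v_coinduced Xp ext).
Qed.

(** P is a direct summand of some Q (x) B with Q projective over A, which is the case M = B of
    [ext1v_tens]. *)
Lemma ext1v_projective X P : projective (resB X) ->
  (forall Q, projective Q -> ext1v (barA X) Q) -> projective P -> ext1v X P.
Proof.
move=> Xp ext Pp; have [Q [p [Qp p_surj]]] := tens_cover rB P.
have [s ps] := projective_section p_surj Pp.
apply: (@ext1v_retract_coeff _ _ _ _ 1 (fun=> s) (fun=> p)) => [x|].
  by rewrite big_ord1.
exact: ext1v_tens Xp (ext Q Qp) (kdim_kbasis rB).
Qed.

(* [1 - phi] is nilpotent because the radical of B is. *)
Lemma unipotent_left_inverse M (phi : {linear M -> M}) : projective M ->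
  (forall x, x - phi x \in rad M) ->
  exists chi : {linear M -> M}, forall x, chi (phi x) = x.
Proof.
move=> Mp rphi; pose n := kbdim rB.
have [psi psiE] : exists psi : {linear M -> M}, forall x, psi x = x - phi x.
  by exists (idfun \- phi).
have psi_lin m : linear (iter m psi).
  by elim: m => // m IHm a u v; rewrite iterS IHm linearP.
(* The induction trades one application of [psi], whose values lie in J M, for one more entry of
   [s]. When none is left, the product of the entries vanishes already in B, so M may have infinite
   dimension. *)
have psin m (s : seq B) x : {in s, forall y, y \in J} -> (n <= size s + m)%N ->
    foldr (fun y z => y *: z) (iter m psi x) s = 0.
  elim: m s x => [|m IHm] s x Js; rewrite ?addn0 => ns.
    have fE : foldr (fun y z => y *: z) x s =
        foldr (fun y z => y *: z) (1 : B^o) s *: x.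
      by elim: (s) => [|y s' /= ->]; rewrite ?scale1r ?scalerA.
    by rewrite /= fE (rad_nilpotent _ (kdim_kbasis rB) ns Js) scale0r.
  have [l [j [y [Jj yE]]]] := rad_projective Mp (rphi x).
  rewrite iterSr psiE yE -[iter m psi _]/(mklin (psi_lin m) _) linear_sum.
  have fD (t : seq B) (u v : M) : foldr (fun y z => y *: z) (u + v) t =
      foldr (fun y z => y *: z) u t + foldr (fun y z => y *: z) v t.
    by elim: t => //= a t ->; rewrite scalerDr.
  have f0 (t : seq B) : foldr (fun y (z : M) => y *: z) 0 t = 0.
    by elim: t => //= a t ->; rewrite scaler0.
  rewrite (big_morph (fun z => foldr (fun y z => y *: z) z s) (fD s) (f0 s)).
  rewrite big1 // => i _; rewrite linearZ /=.
  rewrite -[LHS](foldr_rcons (fun y z => y *: z)) IHm //.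
    by move=> a; rewrite mem_rcons inE => /predU1P[->|/Js].
  by rewrite size_rcons addSnnS.
have [|chi chiE] := @nilpotent_left_inverse _ n M psi.
  by move=> x; apply: (psin n [::] x).
by exists chi => x; rewrite -[RHS]chiE psiE subKr.
Qed.

(** A retraction of [ub] exists over B by semisimplicity and lifts to [v : Y -> X] by projectivity.
    Then [v] after [u] is the identity modulo the radical, hence has a left inverse. *)
Lemma bar_lift_split X Y (u : {linear X -> Y}) (ub : {linear bar X -> bar Y}) :
  (forall x, ub (barp X x) = barp Y (u x)) -> injective ub ->
  projective (resB X) -> projective (resB Y) ->
  exists r : {linear resB Y -> resB X}, forall x, r (u x) = x.
Proof.
move=> ubE ub_inj Xp Yp.
have killed : rad_killed (restrict_scalars (tensr T) (bar Y)).
  apply: (rad_killed_quotient (M := resB Y) (p := restrict_lin (tensr T) (barp Y))).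
    exact: barp_surj.
  by move=> y /barp0.
have [t tu] := semisimple_killed killed (i := restrict_lin (tensr T) ub) ub_inj.
have [v vE] := Yp _ _ (restrict_lin (tensr T) (barp X))
  (t \o restrict_lin (tensr T) (barp Y)) (barp_surj (X := X)).
have [|chi chiE] := @unipotent_left_inverse (resB X) (v \o restrict_lin (tensr T) u) Xp.
  move=> x; apply/barp0; rewrite linearB.
  have -> : barp X ((v \o restrict_lin (tensr T) u) x) = barp X x.
    apply: etrans (vE (u x)) _; rewrite /= -ubE; exact: tu.
  exact: subrr.
by exists (chi \o v) => x; exact: chiE.
Qed.

Lemma GPc_bar X : projective (resB X) -> GPc (barA X) -> GPc X.
Proof.
move=> Xp GX.
exists (fun Y => projective (resB Y) /\ GPc (barA Y)); last by [].
move=> {Xp GX} {}X [Xp GX]; have [ext [C [Q [f [q [fq Qp GC]]]]] _] := GPc_class GX.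
split.
- by move=> P; exact: ext1v_projective.
- have [h hE] := bar_coinduce f.
  have [F [p [Fp p_surj [m Fm]]]] := kdim_cover (kdim_kbasis eD).
  have [K [i ip]] := ses_kernel p_surj; have [i_inj _ _] := ip.
  have [eF _] := kbasis_exists Fm.
  have Km := kdim_submodule i_inj Fm.
  have [eK _] := kbasis_exists Km.
  have sQ := tens_map_ses T rB Q eK eF eD ip.
  have [u uE] := ext1v_lift sQ (ext1v_tens (e := eK) Xp (ext Q Qp) Km) h.
  pose P := Q ⊗ eF; have Pp : projective P := tens_projective Qp Fp.
  have PpB : projective (resB P) := projective_resB rB Pp.
  have [w wE] := bar_coinduce_inv (tens_map T rB Q eF eD p) PpB.
  have [ub ubE] := bar_map u.
  (* Both sides correspond to [h] under the adjunction. So [ub] inherits injectivity from [f], and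
     [w] carries one embedding of X/JX back to the other. *)
  have wub v : w (ub v) = f v.
    have [x <-] := barp_surj v; rewrite ubE.
    by apply: bar_eq => j; rewrite wE uE hE.
  have [f_inj _ _] := fq.
  have ub_inj : injective ub.
    by move=> x y e; apply: f_inj; rewrite -!wub e.
  have [r ru] := bar_lift_split ubE ub_inj Xp PpB.
  have [Y [z uz]] := ses_cokernel (can_inj ru).
  have YpB : projective (resB Y).
    have [s zs] := ses_section (restrict_ses (tensr T) uz) ru.
    exact: projective_retract zs PpB.
  have [u' [z' [uz' u'E z'E]]] := bar_ses uz YpB.
  have u'ub v : u' v = ub v by have [x <-] := barp_surj v; rewrite u'E ubE.
  have [extC _ _] := GPc_class GC.
  (* [e] extends the embedding of X/JX into the reduction of P over Q, since Ext^1 from C to that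
     projective module vanishes. Together with [w] it gives the comparison maps in both directions
     for [dual_schanuel]. *)
  have [e ef] := extC _ (bar_projective Pp) _ _ _ _ fq (restrict_lin (tensl T) u').
  exists Y, P, u, z; split=> //; split=> //.
  apply: GPc_stable GC; apply: stably_iso_sym.
  apply: (dual_schanuel fq (restrict_ses (tensl T) uz') Qp (bar_projective Pp) ef).
  by move=> v; rewrite -wub -u'ub.
- have [F [p [Fp p_surj _]]] := free_cover X; have [K [i ip]] := ses_kernel p_surj.
  have FpB : projective (resB F) := projective_resB rB Fp.
  exists K, F, i, p; split=> //; split.
    exact: projective_kernel (restrict_ses (tensr T) ip) FpB Xp.
  have [i' [p' [ip' _ _]]] := bar_ses ip Xp.
  exact: GPc_kernel (restrict_ses (tensl T) ip') (bar_projective Fp) GX.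
Qed.

End Main.

Theorem proposition1p2 (k : fieldType) (A : algType k) (B : falgType k)
  (A_coherent : coherent A) (B_gldim : finite_global_dimension B)
  (T : tensor_product A B) (X : lmodType T)
  (X_fp : finitely_presented X) :
  Gorenstein_projective X <->
  Gorenstein_projective (restrict_scalars (tensl T) (modquot (radB X))) /\
  projective (restrict_scalars (tensr T) X).
Proof.
have [rB _] := kbasis_exists (kdim_regular B).
have [rc _] := radical_coordinates_exist B.
split=> [/Gorenstein_GPc GX|[/Gorenstein_GPc GX Xp]].
  have [GbX Xp] := bar_GPc rB rc B_gldim GX.
  by split; first exact: GPc_Gorenstein.
exact: GPc_Gorenstein (GPc_bar rB rc Xp GX).
Qed.
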